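(* Let $\alpha\in(1,\infty)$ and let $\mathcal N,\mathcal M$ be completely positive maps from $\mathscr L(X')$ to $\mathscr L(Y)$, with $X$ a copy of $X'$. Then $D^{\#}_\alpha(\mathcal N\|\mathcal M)=\frac{1}{\alpha-1}\log_2 Q^{\#}_\alpha(\mathcal N\|\mathcal M)$ where $$Q^{\#}_\alpha(\mathcal N\|\mathcal M):=\sup_{\omega\in\mathscr D(X)}Q^{\#}_\alpha\big(\omega^{1/2}J^{\mathcal N}_{XY}\omega^{1/2}\,\big\|\,\omega^{1/2}J^{\mathcal M}_{XY}\omega^{1/2}\big)=\inf\Big\{\|\mathrm{tr}_Y(A_{XY})\|_\infty : A_{XY}\ge0,\ J^{\mathcal N}_{XY}\le J^{\mathcal M}_{XY}\#_{1/\alpha}A_{XY}\Big\}.$$ (Here $\omega^{1/2}$ stands for $\omega^{1/2}\otimes I_Y$, and the infimum of the empty set is $+\infty$.)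
   Context: $\mathscr D(X)$ is the set of density operators on $X$; $\|\cdot\|_\infty$ is the operator norm. For $\beta\in(0,1)$ and positive semidefinite $A,B$, $A\#_\beta B:=\lim_{\varepsilon\downarrow0}A_\varepsilon^{1/2}(A_\varepsilon^{-1/2}B_\varepsilon A_\varepsilon^{-1/2})^{\beta}A_\varepsilon^{1/2}$, $A_\varepsilon=A+\varepsilon I$, $B_\varepsilon=B+\varepsilon I$. For states: $Q^{\#}_\alpha(\rho\|\sigma):=\inf\{\mathrm{tr}(A): A\ge 0,\ \rho\le\sigma\#_{1/\alpha}A\}$, $D^{\#}_\alpha:=\frac{1}{\alpha-1}\log_2 Q^{\#}_\alpha$. Choi operator: $J^{\mathcal N}_{XY}=(\mathcal I_X\otimes\mathcal N)(\Phi_{XX'})$ with $\Phi_{XX'}=\sum_{x,x'}|x\rangle\langle x'|_X\otimes|x\rangle\langle x'|_{X'}$ for a fixed basis. For a divergence $\mathbf D$ on operators, the channel divergence is $\mathbf D(\mathcal N\|\mathcal M):=\sup_{\omega\in\mathscr D(X)}\mathbf D\big((\omega^{1/2}\otimes I_Y)J^{\mathcal N}_{XY}(\omega^{1/2}\otimes I_Y)\,\|\,(\omega^{1/2}\otimes I_Y)J^{\mathcal M}_{XY}(\omega^{1/2}\otimes I_Y)\big)$. *)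

(* Defs.v *)
(* MathComp-Analysis (realType R), complex numbers R[i]
   from mathcomp-real-closed, Kronecker products from real_closed/mxtens. *)
From HB Require Import structures.
From mathcomp Require Import all_boot all_order all_algebra.
From mathcomp Require Import spectral.
From mathcomp Require Import complex mxtens.
From mathcomp Require Import boolp classical_sets functions reals ereal
  topology normedtype sequences exp.

Set Implicit Arguments.
Unset Strict Implicit.
Unset Printing Implicit Defensive.

Import Order.TTheory GRing.Theory Num.Theory numFieldNormedType.Exports.
Local Open Scope classical_set_scope.
Local Open Scope ring_scope.

Section QuantumDefs.
Variable R : realType.
Local Notation C := (R[i]).

(* the embedding R -> C *)
Definition toC (r : R) : C := (r%:C)%C.

(* conjugate transpose *)
Definition adj {k l : nat} (A : 'M[C]_(k, l)) : 'M[C]_(l, k) :=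
  (A ^t*)%sesqui.

(* positive semidefinite operators (Hermitian, nonnegative quadratic form) *)
Definition psd {k : nat} (A : 'M[C]_k) : Prop :=
  adj A = A /\ forall v : 'rV[C]_k, 0 <= (v *m A *m adj v) 0 0.

(* Loewner order A <= B *)
Definition loew {k : nat} (A B : 'M[C]_k) : Prop := psd (B - A).

(* density operators *)
Definition density {k : nat} (w : 'M[C]_k) : Prop := psd w /\ \tr w = 1.

(* spectral decompositions A = U^* diag(d) U of a PSD matrix *)
Definition psd_decomp {k : nat} (A : 'M[C]_k) (p : 'M[C]_k * 'rV[R]_k) : Prop :=
  p.1 \is unitarymx /\ (forall i, 0 <= p.2 0 i) /\
  A = adj p.1 *m diag_mx (map_mx toC p.2) *m p.1.

(* real power A^b of a PSD matrix via functional calculus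
   (independent of the chosen decomposition); 0 if A is not PSD. *)
Definition mxpow {k : nat} (A : 'M[C]_k) (b : R) : 'M[C]_k :=
  match pselect (exists p, psd_decomp A p) with
  | left h => let p := projT1 (cid h) in
      adj p.1 *m diag_mx (map_mx (fun r => toC (r `^ b)) p.2) *m p.1
  | right _ => 0
  end.

(* the matrix A_e^{1/2} (A_e^{-1/2} B_e A_e^{-1/2})^b A_e^{1/2} *)
Definition gm_eps {k : nat} (b : R) (A B : 'M[C]_k) (e : R) : 'M[C]_k :=
  let Ae := A + (toC e)%:M in
  let Be := B + (toC e)%:M in
  let Ah := mxpow Ae (2^-1) in
  Ah *m mxpow (invmx Ah *m Be *m invmx Ah) b *m Ah.

(* weighted geometric mean A #_b B := lim_{e -> 0+} gm_eps b A B e,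
   the limit being taken entrywise (real and imaginary parts) *)
Definition gmean {k : nat} (b : R) (A B : 'M[C]_k) : 'M[C]_k :=
  \matrix_(i, j)
    ((toC (lim ((fun e => complex.Re (gm_eps b A B e i j)) @ (0:R)^'+))) +
     toC (lim ((fun e => complex.Im (gm_eps b A B e i j)) @ (0:R)^'+)) * 'i%C).

(* Q^#_alpha(rho || sigma) *)
Definition Qsharp {k : nat} (a : R) (rho sigma : 'M[C]_k) : \bar R :=
  ereal_inf [set (complex.Re (\tr A))%:E |
             A in [set A : 'M[C]_k | psd A /\ loew rho (gmean a^-1 sigma A)]].

(* extended-real log_2 (log2 0 = -oo, log2 (+oo) = +oo) *)
Definition log2e (x : \bar R) : \bar R := (lne x * ((ln (2 : R))^-1)%:E)%E.

(* D^#_alpha(rho || sigma) *)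
Definition Dsharp {k : nat} (a : R) (rho sigma : 'M[C]_k) : \bar R :=
  (((a - 1)^-1)%:E * log2e (Qsharp a rho sigma))%E.

(* operator norm *)
Definition vnorm {k : nat} (v : 'cV[C]_k) : R :=
  Num.sqrt (\sum_i ((complex.Re (v i 0)) ^+ 2 + (complex.Im (v i 0)) ^+ 2)).
Definition opnorm {k : nat} (M : 'M[C]_k) : R :=
  sup [set r | exists v : 'cV[C]_k, vnorm v = 1 /\ r = vnorm (M *m v)].

(* operators on X (x) Y are 'M_(n * m), indexed by mxtens_index (x, y) *)
Definition ptrY {n m : nat} (A : 'M[C]_(n * m)) : 'M[C]_n :=
  \matrix_(i, i') \sum_(j < m) A (mxtens_index (i, j)) (mxtens_index (i', j)).

(* block (x, x') of an operator on Z (x) X' *)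
Definition blk {k n : nat} (Z : 'M[C]_(k * n)) (x x' : 'I_k) : 'M[C]_n :=
  \matrix_(a, b) Z (mxtens_index (x, a)) (mxtens_index (x', b)).

(* (id_k (x) N)(Z) *)
Definition idtens {k n m : nat} (N : 'M[C]_n -> 'M[C]_m) (Z : 'M[C]_(k * n))
  : 'M[C]_(k * m) :=
  \sum_(x < k) \sum_(x' < k) (delta_mx x x' *t N (blk Z x x')).

(* complete positivity: id_k (x) N is positive for every k *)
Definition completely_positive {n m : nat} (N : 'M[C]_n -> 'M[C]_m) : Prop :=
  forall (k : nat) (Z : 'M[C]_(k * n)), psd Z -> psd (idtens N Z).

(* Choi operator J^N_{XY} = (I_X (x) N)(Phi_{XX'}) *)
Definition choi {n m : nat} (N : 'M[C]_n -> 'M[C]_m) : 'M[C]_(n * m) :=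
  \sum_(x < n) \sum_(x' < n) (delta_mx x x' *t N (delta_mx x x')).

(* (w^{1/2} (x) I_Y) J (w^{1/2} (x) I_Y) *)
Definition sandwich {n m : nat} (w : 'M[C]_n) (J : 'M[C]_(n * m)) : 'M[C]_(n * m) :=
  let W := mxpow w (2^-1) *t (1%:M : 'M[C]_m) in W *m J *m W.

(* channel divergences *)
Definition Qsharp_ch {n m : nat} (a : R) (N M : 'M[C]_n -> 'M[C]_m) : \bar R :=
  ereal_sup [set Qsharp a (sandwich w (choi N)) (sandwich w (choi M)) |
             w in [set w : 'M[C]_n | density w]].

Definition Dsharp_ch {n m : nat} (a : R) (N M : 'M[C]_n -> 'M[C]_m) : \bar R :=
  ereal_sup [set Dsharp a (sandwich w (choi N)) (sandwich w (choi M)) |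
             w in [set w : 'M[C]_n | density w]].

End QuantumDefs.

(* Main.v *)
(** If [A = G^* G] and [B = G^* diag(d) G] then [A #_b B = G^* diag(d^b) G].
    For positive definite arguments, [sum_i T_i A_i T_i^* <= A] and
    [sum_i T_i B_i T_i^* <= B] imply
    [sum_i T_i (A_i #_b B_i) T_i^* <= A #_b B]: the set of such [b] is closed,
    contains 0 and 1, and is stable under midpoints, because [A #_((s+t)/2) B] is
    the largest Hermitian [X] for which the block matrix
    [[A #_s B, X], [X, A #_t B]] is positive semidefinite.  This gives at once
    the monotonicity in [epsilon] that makes the defining limit exist, the
    transformer inequality [T (A # B) T^* <= (T A T^* ) # (T B T^* )] for every [T],
    and the convexity of the feasible set.

    By the transformer inequality with [T = omega^(1/2)], and with its inverse
    when [omega] is invertible, the optimization for [omega] becomes the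
    infimum of [tr (omega tr_Y A)] over the feasible set of the channel problem.
    The remaining minimax equality follows by separating [0] from the convex
    set of all [tr_Y A - c I + P], [P >= 0], with its point of minimal norm [H]:
    [H] is positive semidefinite, and a small multiple of [I] added to it gives,
    after normalization, an invertible [omega] of value at least [c]. *)
Require Import Defs.
From HB Require Import structures.
From mathcomp Require Import all_boot all_order all_algebra.
From mathcomp Require Import spectral complex mxtens.
From mathcomp Require Import boolp classical_sets functions reals ereal
  topology normedtype sequences exp realfun.
From mathcomp Require Import ring lra.

Set Implicit Arguments.
Unset Strict Implicit.
Unset Printing Implicit Defensive.

Import Order.TTheory GRing.Theory Num.Theory numFieldNormedType.Exports.
Local Open Scope classical_set_scope.
Local Open Scope ring_scope.

(** * Positive semidefinite matrices *)

Section Psd.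
Variable R : realType.
Local Notation C := (R[i]).

(** * Adjoints, and the reals inside the complex numbers *)

Lemma adjE k l (A : 'M[C]_(k, l)) i j : adj A i j = (A j i)^*.
Proof. by rewrite /adj !mxE. Qed.

Lemma adjK k l (A : 'M[C]_(k, l)) : adj (adj A) = A.
Proof. exact: trmxCK. Qed.

Lemma adjM k l p (A : 'M[C]_(k, l)) (B : 'M[C]_(l, p)) :
  adj (A *m B) = adj B *m adj A.
Proof. by rewrite /adj trmx_mul map_mxM. Qed.

Lemma adjD k l (A B : 'M[C]_(k, l)) : adj (A + B) = adj A + adj B.
Proof. by apply/matrixP => i j; rewrite !mxE rmorphD. Qed.

Lemma adjN k l (A : 'M[C]_(k, l)) : adj (- A) = - adj A.
Proof. by apply/matrixP => i j; rewrite !mxE rmorphN. Qed.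

Lemma adjB k l (A B : 'M[C]_(k, l)) : adj (A - B) = adj A - adj B.
Proof. by rewrite adjD adjN. Qed.

Lemma adj_congr k l (T : 'M[C]_(l, k)) (A : 'M[C]_k) :
  adj (T *m A *m adj T) = T *m adj A *m adj T.
Proof. by rewrite !adjM adjK mulmxA. Qed.

Lemma adj_congrl k l (T : 'M[C]_(k, l)) (A : 'M[C]_k) :
  adj (adj T *m A *m T) = adj T *m adj A *m T.
Proof. by rewrite !adjM adjK mulmxA. Qed.

Lemma congrl_cancel k (T S A : 'M[C]_k) : S *m T = 1%:M ->
  adj T *m (adj S *m A *m S) *m T = A.
Proof.
move=> ST; rewrite !mulmxA -adjM ST -mulmxA ST mulmx1.
by rewrite -[X in adj X]trmx1 /adj trmxK map_mx1 mul1mx.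
Qed.

Lemma adj_scale k l c (A : 'M[C]_(k, l)) : adj (c *: A) = c^* *: adj A.
Proof. by apply/matrixP => i j; rewrite !mxE rmorphM. Qed.

Lemma adj0 k l : adj (0 : 'M[C]_(k, l)) = 0.
Proof. by apply/matrixP => i j; rewrite !mxE rmorph0. Qed.

Lemma conj_toC (r : R) : (toC r)^* = toC r.
Proof. exact: conjc_real. Qed.

Lemma adj_scalar k (r : R) : adj ((toC r)%:M : 'M[C]_k) = (toC r)%:M.
Proof.
apply/matrixP => i j; rewrite !mxE eq_sym; case: eqP => _.
  exact: conj_toC.
exact: rmorph0.
Qed.

Lemma toC1 : toC 1 = 1 :> C. Proof. by []. Qed.

Lemma toCM (x y : R) : toC (x * y) = toC x * toC y.
Proof. exact: rmorphM. Qed.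

Lemma toCD (x y : R) : toC (x + y) = toC x + toC y.
Proof. exact: rmorphD. Qed.

Lemma toCB (x y : R) : toC (x - y) = toC x - toC y.
Proof. exact: rmorphB. Qed.

Lemma adjmx1 k : adj (1%:M : 'M[C]_k) = 1%:M.
Proof. by rewrite -toC1 adj_scalar. Qed.

Lemma toC_ge0 (r : R) : (0 <= toC r) = (0 <= r).
Proof. exact: ler0c. Qed.

Lemma Re_toC (r : R) : complex.Re (toC r) = r. Proof. by []. Qed.

Lemma ReD (x y : C) : complex.Re (x + y) = complex.Re x + complex.Re y.
Proof. by case: x y => ? ? [? ?]. Qed.

Lemma ReN (x : C) : complex.Re (- x) = - complex.Re x.
Proof. by case: x. Qed.

Lemma ReZ (r : R) (x : C) : complex.Re (toC r * x) = r * complex.Re x.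
Proof. by case: x => a b /=; rewrite mul0r subr0. Qed.

Lemma Re_sum I (r : seq I) (P : pred I) (F : I -> C) :
  complex.Re (\sum_(i <- r | P i) F i) = \sum_(i <- r | P i) complex.Re (F i).
Proof. by apply: (big_morph (@complex.Re R) ReD). Qed.

Lemma conjE (x : C) : x^* = conjc x. Proof. by []. Qed.

Lemma conjD (x y : C) : (x + y)^* = x^* + y^*. Proof. exact: rmorphD. Qed.

Lemma conjM (x y : C) : (x * y)^* = x^* * y^*. Proof. exact: rmorphM. Qed.

Lemma conjN (x : C) : (- x)^* = - x^*. Proof. exact: rmorphN. Qed.

Lemma Re_conjc (x : C) : complex.Re x^* = complex.Re x.
Proof. by rewrite conjE; case: x. Qed.

Lemma Im_conjc (x : C) : complex.Im x^* = - complex.Im x.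
Proof. by rewrite conjE; case: x. Qed.

Lemma ge0_toC (z : C) : 0 <= z -> z = toC (complex.Re z).
Proof. by case: z => a b; rewrite lecE /= => /andP[/eqP -> _]. Qed.

Lemma ge0_Re (z : C) : 0 <= z -> 0 <= complex.Re z.
Proof. by move=> /[dup] /ge0_toC {1}-> ; rewrite toC_ge0. Qed.

Lemma conj_id_toC (z : C) : z^* = z -> z = toC (complex.Re z).
Proof.
rewrite conjE; case: z => a b [] /eqP.
by rewrite eq_sym -addr_eq0 -mulr2n mulrn_eq0 /= => /eqP ->.
Qed.

(** * Real diagonal matrices and sesquilinear forms *)

Definition rdiag k (d : 'rV[R]_k) : 'M[C]_k := diag_mx (map_mx (@toC R) d).

Lemma adj_rdiag k (d : 'rV[R]_k) : adj (rdiag d) = rdiag d.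
Proof.
apply/matrixP => i j; rewrite !mxE eq_sym; case: eqP => [->|_].
  exact: conj_toC.
exact: rmorph0.
Qed.

Lemma rdiagM k (d e : 'rV[R]_k) :
  rdiag d *m rdiag e = rdiag (\row_i (d 0 i * e 0 i)).
Proof.
rewrite /rdiag mulmx_diag; congr diag_mx.
by apply/rowP => i; rewrite !mxE toCM.
Qed.

Lemma rdiag1 k : rdiag (const_mx 1) = 1%:M :> 'M[C]_k.
Proof. by apply/matrixP => i j; rewrite !mxE toC1. Qed.

Lemma rdiag_scalar k (r : R) : rdiag (const_mx r) = (toC r)%:M :> 'M[C]_k.
Proof. by apply/matrixP => i j; rewrite !mxE. Qed.

(* Locked, so that comparing two instances never unfolds matrix products. *)
Fact sform_key : unit. Proof. exact: tt. Qed.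

Definition sform_def k (A : 'M[C]_k) (u v : 'rV[C]_k) : C := (u *m A *m adj v) 0 0.

Definition sform := locked_with sform_key sform_def.

Lemma sformE k (A : 'M[C]_k) u v : sform A u v = (u *m A *m adj v) 0 0.
Proof. by rewrite /sform unlock. Qed.

Lemma sformDl k (A : 'M[C]_k) u v w : sform A (u + v) w = sform A u w + sform A v w.
Proof. by rewrite !sformE !mulmxDl mxE. Qed.

Lemma sformDr k (A : 'M[C]_k) u v w : sform A w (u + v) = sform A w u + sform A w v.
Proof. by rewrite !sformE adjD mulmxDr mxE. Qed.

Lemma sformZl k (A : 'M[C]_k) c u v : sform A (c *: u) v = c * sform A u v.
Proof. by rewrite !sformE -!scalemxAl mxE. Qed.

Lemma sformZr k (A : 'M[C]_k) c u v : sform A u (c *: v) = c^* * sform A u v.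
Proof. by rewrite !sformE adj_scale -scalemxAr mxE. Qed.

Lemma sformD k (A B : 'M[C]_k) u v : sform (A + B) u v = sform A u v + sform B u v.
Proof. by rewrite !sformE mulmxDr mulmxDl mxE. Qed.

Lemma sformN k (A : 'M[C]_k) u v : sform (- A) u v = - sform A u v.
Proof. by rewrite !sformE mulmxN mulNmx mxE. Qed.

Lemma sformB k (A B : 'M[C]_k) u v : sform (A - B) u v = sform A u v - sform B u v.
Proof. by rewrite sformD sformN. Qed.

Lemma sformZ k c (A : 'M[C]_k) u v : sform (c *: A) u v = c * sform A u v.
Proof. by rewrite !sformE -scalemxAr -scalemxAl mxE. Qed.

Lemma sform_congr k l (T : 'M[C]_(l, k)) (A : 'M[C]_k) u v :
  sform (T *m A *m adj T) u v = sform A (u *m T) (v *m T).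
Proof. by rewrite !sformE adjM !mulmxA. Qed.

Lemma sform_congrl k l (T : 'M[C]_(k, l)) (A : 'M[C]_k) u v :
  sform (adj T *m A *m T) u v = sform A (u *m adj T) (v *m adj T).
Proof. by rewrite -sform_congr adjK. Qed.

Lemma sform_conj k (A : 'M[C]_k) u v : (sform A u v)^* = sform (adj A) v u.
Proof. by rewrite !sformE -adjE !adjM adjK mulmxA. Qed.

Lemma sform_sum k (A : 'M[C]_k) u v :
  sform A u v = \sum_i \sum_j u 0 i * A i j * (v 0 j)^*.
Proof.
rewrite !sformE mxE exchange_big; apply: eq_bigr => j _.
by rewrite adjE mxE mulr_suml; apply: eq_bigr.
Qed.

Lemma sform_rdiag k (d : 'rV[R]_k) u v :
  sform (rdiag d) u v = \sum_i toC (d 0 i) * (u 0 i * (v 0 i)^*).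
Proof.
rewrite sform_sum; apply: eq_bigr => i _; rewrite (bigD1 i) //= big1 ?addr0.
  by rewrite !mxE eqxx mulr1n mulrCA mulrA.
by move=> j ji; rewrite !mxE eq_sym (negbTE ji) mulr0n mulr0 mul0r.
Qed.

Lemma sform_herm k (A : 'M[C]_k) v : adj A = A ->
  sform A v v = toC (complex.Re (sform A v v)).
Proof. by move=> hA; apply: conj_id_toC; rewrite sform_conj hA. Qed.

(** * Positivity and the Loewner order through quadratic forms *)

Lemma psdI k (A : 'M[C]_k) : adj A = A -> (forall v, 0 <= sform A v v) -> psd A.
Proof. by move=> hA pA; split=> // v; rewrite -sformE. Qed.

Lemma psd_sform k (A : 'M[C]_k) v : psd A -> 0 <= sform A v v.
Proof. by move=> [_ pA]; rewrite sformE. Qed.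

Lemma psdE k (A : 'M[C]_k) :
  psd A <-> adj A = A /\ forall v, 0 <= complex.Re (sform A v v).
Proof.
split=> [pA|[hA pA]].
  by split=> [|v]; [exact: pA.1|exact/ge0_Re/psd_sform].
by apply: psdI => // v; rewrite sform_herm // toC_ge0.
Qed.

Lemma loewE k (A B : 'M[C]_k) : adj A = A -> adj B = B ->
  (forall v, complex.Re (sform A v v) <= complex.Re (sform B v v)) -> loew A B.
Proof.
move=> hA hB h; apply/psdE; split; first by rewrite adjB hA hB.
by move=> v; rewrite sformB ReD ReN subr_ge0.
Qed.

Lemma loew_sform k (A B : 'M[C]_k) v : loew A B ->
  complex.Re (sform A v v) <= complex.Re (sform B v v).
Proof. by move=> /psdE[_ /(_ v)]; rewrite sformB ReD ReN subr_ge0. Qed.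

Lemma psd_congr k l (T : 'M[C]_(l, k)) (A : 'M[C]_k) :
  psd A -> psd (T *m A *m adj T).
Proof.
move=> pA; apply: psdI; first by rewrite adj_congr pA.1.
by move=> v; rewrite sform_congr psd_sform.
Qed.

Lemma psd_congrl k l (T : 'M[C]_(k, l)) (A : 'M[C]_k) :
  psd A -> psd (adj T *m A *m T).
Proof. by move=> /(psd_congr (adj T)); rewrite adjK. Qed.

Lemma psd_rdiag k (d : 'rV[R]_k) : (forall i, 0 <= d 0 i) -> psd (rdiag d).
Proof.
move=> d0; apply: psdI; first exact: adj_rdiag.
move=> v; rewrite sform_rdiag; apply: sumr_ge0 => i _.
by rewrite mulr_ge0 ?toC_ge0 // mulcJ_ge0.
Qed.

Lemma psd0 k : psd (0 : 'M[C]_k).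
Proof. by split=> [|v]; [rewrite adj0|rewrite mulmx0 mul0mx mxE]. Qed.

Lemma psdD k (A B : 'M[C]_k) : psd A -> psd B -> psd (A + B).
Proof.
move=> pA pB; apply: psdI; first by rewrite adjD pA.1 pB.1.
by move=> v; rewrite sformD addr_ge0 // psd_sform.
Qed.

Lemma psdZ k (r : R) (A : 'M[C]_k) : 0 <= r -> psd A -> psd (toC r *: A).
Proof.
move=> r0 pA; apply: psdI; first by rewrite adj_scale conj_toC pA.1.
by move=> v; rewrite sformZ mulr_ge0 ?toC_ge0 // psd_sform.
Qed.

Lemma psd_scalar k (r : R) : 0 <= r -> psd ((toC r)%:M : 'M[C]_k).
Proof. by move=> r0; rewrite -rdiag_scalar; apply: psd_rdiag => i; rewrite mxE. Qed.

Lemma psd1 k : psd (1%:M : 'M[C]_k).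
Proof. by rewrite -toC1; apply: psd_scalar. Qed.

Lemma psd_gram k l (T : 'M[C]_(k, l)) : psd (adj T *m T).
Proof. by rewrite -[adj T]mulmx1; apply/psd_congrl/psd1. Qed.

Lemma loew_refl k (A : 'M[C]_k) : loew A A.
Proof. by rewrite /loew subrr; apply: psd0. Qed.

Lemma loew_trans k (B A D : 'M[C]_k) : loew A B -> loew B D -> loew A D.
Proof. by move=> AB BD; have := psdD BD AB; rewrite addrA subrK. Qed.

Lemma loewD k (A B A' B' : 'M[C]_k) : loew A B -> loew A' B' -> loew (A + A') (B + B').
Proof. by move=> h h'; have := psdD h h'; rewrite addrACA -opprD. Qed.

Lemma loew_congr k l (T : 'M[C]_(l, k)) (A B : 'M[C]_k) :
  loew A B -> loew (T *m A *m adj T) (T *m B *m adj T).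
Proof. by move=> h; rewrite /loew -mulmxBl -mulmxBr; apply: psd_congr. Qed.

Lemma loew_congrl k l (T : 'M[C]_(k, l)) (A B : 'M[C]_k) :
  loew A B -> loew (adj T *m A *m T) (adj T *m B *m T).
Proof. by move=> /(loew_congr (adj T)); rewrite adjK. Qed.

(** * Spectral decompositions and functional calculus *)

Lemma unitary_adjr k (U : 'M[C]_k) : U \is unitarymx -> U *m adj U = 1%:M.
Proof. by move=> /unitarymxP. Qed.

Lemma unitary_adjl k (U : 'M[C]_k) : U \is unitarymx -> adj U *m U = 1%:M.
Proof. by move=> /unitary_adjr /mulmx1C. Qed.

(** A Hermitian matrix is normal, so the spectral theorem applies; its spectrum is real, so taking
    real parts loses nothing. *)
Lemma herm_decomp k (A : 'M[C]_k) : adj A = A ->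
  exists (U : 'M[C]_k) (d : 'rV[R]_k),
    U \is unitarymx /\ A = adj U *m rdiag d *m U.
Proof.
move=> hA; have hs : A \is hermsymmx.
  by apply/is_hermitianmxP; rewrite expr0 scale1r -[LHS]hA.
have nA := hermitian_normalmx hs.
have /orthomx_spectralP eA := nA.
have rA := hermitian_spectral_diag_real hs.
have uA := spectral_unitarymx A.
have dE : rdiag (map_mx (@complex.Re R) (spectral_diag A)) =
    diag_mx (spectral_diag A).
  congr diag_mx; apply/rowP => i; rewrite !mxE; apply/esym/conj_id_toC.
  by move/mxOverP: rA => /(_ 0 i) /CrealP.
exists (spectralmx A), (map_mx (@complex.Re R) (spectral_diag A)).
split; first exact: uA.
by rewrite dE; move: eA; rewrite (invmx_unitary uA).
Qed.

Lemma psd_decomp_rdiag k (A : 'M[C]_k) p : psd_decomp A p ->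
  A = adj p.1 *m rdiag p.2 *m p.1.
Proof. by case=> _ []. Qed.

(** The rows of [U] are orthonormal eigenvectors, so evaluating the form at one of them isolates one
    eigenvalue. Bounds on eigenvalues are obtained this way. *)
Lemma sform_row_unitary k (U : 'M[C]_k) (d : 'rV[R]_k) i : U \is unitarymx ->
  sform (adj U *m rdiag d *m U) (row i U) (row i U) = toC (d 0 i).
Proof.
move=> uU; rewrite sform_congrl -row_mul unitary_adjr // sform_rdiag.
rewrite (bigD1 i) //= big1 ?addr0 => [|j ji].
  by rewrite !mxE eqxx /= conjC1 !mulr1.
by rewrite !mxE eq_sym (negbTE ji) mul0r mulr0.
Qed.

Lemma psd_has_decomp k (A : 'M[C]_k) : psd A -> exists p, psd_decomp A p.
Proof.
move=> pA; have [U [d [uU eA]]] := herm_decomp pA.1.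
exists (U, d); split; first exact: uU.
split; last exact: eA.
move=> i /=; have := psd_sform (row i U) pA.
by rewrite {1}eA sform_row_unitary // toC_ge0.
Qed.

(** Entrywise the hypothesis says [W i j * d_j = e_i * W i j]: wherever [W i j] is nonzero,
    [d_j = e_i], and hence [f d_j = f e_i]. *)
Lemma rdiag_intertwine k (f : R -> R) (W : 'M[C]_k) (d e : 'rV[R]_k) :
  W *m rdiag d = rdiag e *m W ->
  W *m rdiag (\row_i f (d 0 i)) = rdiag (\row_i f (e 0 i)) *m W.
Proof.
move=> WE; apply/matrixP => i j; move/matrixP: WE => /(_ i j).
rewrite /rdiag !mul_mx_diag !mul_diag_mx !mxE.
have [-> _|Wn0] := eqVneq (W i j) 0; first by rewrite mul0r mulr0.
by rewrite mulrC => /(mulIf Wn0)/complexI ->; rewrite mulrC.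
Qed.

(** [mxpow] picks a decomposition by choice. The unitary [W = V U^*] between the chosen basis and
    the given one intertwines the two spectra, hence also their powers. *)
Lemma mxpow_decomp k (A : 'M[C]_k) b U d : psd_decomp A (U, d) ->
  mxpow A b = adj U *m rdiag (\row_i (d 0 i `^ b)) *m U.
Proof.
move=> hp; rewrite /mxpow; case: pselect => [h|[]]; last by exists (U, d).
case: (cid h) => -[V e] /= [/= uV [e0 eA']]; case: hp => /= uU [d0 eA].
pose W := V *m adj U.
have WE : W *m rdiag d = rdiag e *m W.
  have := congr1 (fun X => V *m X *m adj U) (etrans (esym eA) eA').
  rewrite /= !mulmxA (unitary_adjr uV) mul1mx -/W.
  by rewrite -(mulmxA _ U) (unitary_adjr uU) mulmx1 -mulmxA.
have WE' := rdiag_intertwine (fun x => x `^ b) WE.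
have -> : diag_mx (map_mx (fun r => toC (r `^ b)) e) = rdiag (\row_i (e 0 i `^ b)).
  by congr diag_mx; apply/rowP => i; rewrite !mxE.
have -> : adj U = adj V *m W by rewrite /W mulmxA (unitary_adjl uV) mul1mx.
rewrite -(mulmxA _ W) WE' -!mulmxA; congr (_ *m (_ *m _)).
by rewrite /W -?mulmxA (unitary_adjl uU) mulmx1.
Qed.

End Psd.
Arguments rdiag {R k} d.

(** * Simultaneous diagonalization and the transformer inequality *)

Section Mean.
Variable R : realType.
Local Notation C := (R[i]).

(** Bisection: at stage [n], [b] lies between two points of [S] at distance [2^-n]. *)
Lemma midpoint_dense (S : set R) : S 0 -> S 1 ->
  (forall s t, S s -> S t -> S ((s + t) / 2)) ->
  forall b e, 0 <= b <= 1 -> 0 < e -> exists2 a, S a & `|b - a| < e.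
Proof.
move=> S0 S1 Sm b e /andP[b0 b1] e0.
have H n : exists a c, [/\ S a, S c, a <= b <= c & c - a = 2^-1 ^+ n].
  elim: n => [|n [a [c [Sa Sc /andP[ab bc] ca]]]].
    by exists 0, 1; rewrite b0 b1 subr0 expr0.
  have Sac := Sm _ _ Sa Sc; have [h|h] := leP ((a + c) / 2) b.
    exists ((a + c) / 2), c; split=> //; first by rewrite h bc.
    by rewrite exprS -ca; field.
  exists a, ((a + c) / 2); split=> //; first by rewrite ab ltW.
  by rewrite exprS -ca; field.
have h2 : `|2^-1 : R| < 1 by rewrite ger0_norm ?invr_ge0 // invf_lt1 ?ltr1n.
have /cvgrPdist_lt /(_ _ e0) [n _ /(_ n (leqnn n))] := cvg_geometric 1 h2.
rewrite /= sub0r normrN mul1r ger0_norm ?exprn_ge0 ?invr_ge0 // => hn.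
have [a [c [Sa Sc /andP[ab bc] ca]]] := H n.
exists a => //; rewrite ger0_norm ?subr_ge0 //; apply: le_lt_trans hn.
by rewrite -ca lerB.
Qed.

Lemma sform_psd_ge0 k (A : 'M[C]_k) v : psd A -> 0 <= complex.Re (sform A v v).
Proof. by move=> /psdE[]. Qed.

(* If [w (q - X) = e w] with [e < 0], the hypothesis at [u = - w X], [v = w]
   gives [|w q|^2 >= |w X|^2 = |w q - e w|^2], which is impossible. *)
Lemma loew_of_block k (X : 'M[C]_k) (q : 'rV[R]_k) : adj X = X ->
  (forall i, 0 <= q 0 i) ->
  (forall u v, 0 <= complex.Re (sform 1%:M u u + sform X u v + sform X v u +
                                sform (rdiag (\row_i (q 0 i ^+ 2))) v v)) ->
  loew X (rdiag q).
Proof.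
move=> hX q0 hb.
have hY : adj (rdiag q - X) = rdiag q - X by rewrite adjB adj_rdiag hX.
have [U [e [uU eY]]] := herm_decomp hY.
rewrite /loew eY; apply/psd_congrl/psd_rdiag => i; rewrite leNgt; apply/negP => ei.
set w := row i U; pose z := w *m rdiag q.
have wY : w *m (rdiag q - X) = toC (e 0 i) *: w.
  rewrite eY !mulmxA -row_mul (unitary_adjr uU) -!row_mul mul1mx /w.
  by apply/rowP => j; rewrite /rdiag mul_diag_mx !mxE.
have wX : w *m X = z - toC (e 0 i) *: w.
  by rewrite -wY mulmxBr opprB addrC subrK.
have w1 : sform 1%:M w w = 1.
  have := sform_row_unitary (const_mx 1) i uU.
  by rewrite rdiag1 mulmx1 (unitary_adjl uU) mxE.
have := hb (- (w *m X)) w.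
have -> : sform (rdiag (\row_i (q 0 i ^+ 2))) w w = sform 1%:M z z.
  rewrite -sform_congr mulmx1 adj_rdiag rdiagM.
  by congr (sform (rdiag _) _ _); apply/rowP => j; rewrite !mxE expr2.
have -> : sform X (- (w *m X)) w = - sform 1%:M (w *m X) (w *m X).
  rewrite -scaleN1r sformZl mulN1r; congr (- _).
  by rewrite -sform_congr mulmx1 hX !sformE !mulmxA.
have -> : sform X w (- (w *m X)) = - sform 1%:M (w *m X) (w *m X).
  rewrite -scaleN1r sformZr rmorphN1 mulN1r; congr (- _).
  by rewrite !sformE !mulmx1.
have -> : sform 1%:M (- (w *m X)) (- (w *m X)) = sform 1%:M (w *m X) (w *m X).
  by rewrite -scaleN1r sformZr sformZl rmorphN1 mulrA mulrNN !mul1r.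
rewrite subrr sub0r wX -scaleNr !sformDl !sformDr !sformZl !sformZr w1.
have zw : sform 1%:M z w = sform (rdiag q) w w by rewrite !sformE mulmx1.
have wz : sform 1%:M w z = sform (rdiag q) w w.
  by rewrite !sformE /z adjM adj_rdiag mulmx1 mulmxA.
rewrite zw wz !ReD !ReN conjN conj_toC.
have rq := sform_psd_ge0 w (psd_rdiag q0).
set r := sform (rdiag q) w w in rq *.
rewrite !mulNr !mulrN !mulr1 !opprK -toCM !ReD !ReN Re_toC !ReZ.
(* With [e = e 0 i < 0], the claim is that [2 e r - e^2] cannot be nonnegative; [r] is the value of
   [diag(q)] at [w], hence nonnegative. *)
by nra.
Qed.

Fact congdiag_key : unit. Proof. exact: tt. Qed.

(** For invertible [G] and positive [d], this is the weighted mean of [G^* G] and [G^* diag(d) G].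
    The formula makes sense for every real [b], and its dependence on [b] sits in scalar powers
    only. *)
Definition congdiag_def k (G : 'M[C]_k) (d : 'rV[R]_k) (b : R) : 'M[C]_k :=
  adj G *m rdiag (\row_i (d 0 i `^ b)) *m G.

Definition congdiag := locked_with congdiag_key congdiag_def.

Lemma congdiagE k (G : 'M[C]_k) (d : 'rV[R]_k) b :
  congdiag G d b = adj G *m rdiag (\row_i (d 0 i `^ b)) *m G.
Proof. by rewrite /congdiag unlock. Qed.

Lemma adj_congdiag k (G : 'M[C]_k) (d : 'rV[R]_k) b :
  adj (congdiag G d b) = congdiag G d b.
Proof. by rewrite !congdiagE !adjM adjK adj_rdiag mulmxA. Qed.

Lemma congdiag0 k (G : 'M[C]_k) (d : 'rV[R]_k) : congdiag G d 0 = adj G *m G.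
Proof.
rewrite congdiagE (_ : \row_i _ = const_mx 1) ?rdiag1 ?mulmx1 //.
by apply/rowP => i; rewrite !mxE powRr0.
Qed.

Lemma congdiag1 k (G : 'M[C]_k) (d : 'rV[R]_k) : (forall i, 0 < d 0 i) ->
  congdiag G d 1 = adj G *m rdiag d *m G.
Proof.
move=> d0; rewrite congdiagE; congr (_ *m rdiag _ *m _).
by apply/rowP => i; rewrite !mxE powRr1 // ltW.
Qed.

Lemma sform_congdiag k (G : 'M[C]_k) (d : 'rV[R]_k) b u v :
  sform (congdiag G d b) u v =
  \sum_i toC (d 0 i `^ b) * ((u *m adj G) 0 i * ((v *m adj G) 0 i)^*).
Proof.
rewrite congdiagE sform_congrl sform_rdiag.
by apply: eq_bigr => i _; rewrite mxE.
Qed.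

Lemma powRD_gt0 (x r s : R) : 0 < x -> x `^ (r + s) = x `^ r * x `^ s.
Proof. by move=> x0; apply: powRD; rewrite (gt_eqF x0) implybT. Qed.

(** In the coordinates [x], [y] of [u], [v], each summand is the square modulus of
    [d^(s/2) x + d^(t/2) y], since the two factors multiply to [d^m]. *)
Lemma congdiag_block k (G : 'M[C]_k) (d : 'rV[R]_k) s t m u v : (forall i, 0 < d 0 i) ->
  m = (s + t) / 2 ->
  0 <= complex.Re (sform (congdiag G d s) u u + sform (congdiag G d m) u v +
                   sform (congdiag G d m) v u + sform (congdiag G d t) v v).
Proof.
move=> d0 mE; apply: ge0_Re.
rewrite !sform_congdiag.
rewrite -!big_split /=.
apply: sumr_ge0 => i _.
set x := (u *m adj G) 0 i; set y := (v *m adj G) 0 i.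
set a := d 0 i `^ (s / 2); set b := d 0 i `^ (t / 2).
have -> : d 0 i `^ s = a * a by rewrite -powRD_gt0 // -splitr.
have -> : d 0 i `^ t = b * b by rewrite -powRD_gt0 // -splitr.
have -> : d 0 i `^ m = a * b by rewrite mE -powRD_gt0 // mulrDl.
rewrite !toCM; have := mulcJ_ge0 (toC a * x + toC b * y).
rewrite -conjE conjD !conjM !conj_toC; congr (0 <= _); ring.
Qed.

Section Transformer.
Variables (k l : nat) (G : 'M[C]_k) (d : 'rV[R]_k).
Variables (G1 G2 : 'M[C]_l) (d1 d2 : 'rV[R]_l) (T1 T2 : 'M[C]_(k, l)).
Hypotheses (uG : G \in unitmx) (d0 : forall i, 0 < d 0 i).
Hypotheses (d10 : forall i, 0 < d1 0 i) (d20 : forall i, 0 < d2 0 i).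

(** Two terms cover every use: [T2 = 0] for monotonicity and for congruences, scalar [T1] and [T2]
    for convexity. *)
Let X b := T1 *m congdiag G1 d1 b *m adj T1 + T2 *m congdiag G2 d2 b *m adj T2.

Let adjX b : adj (X b) = X b.
Proof. by rewrite /X adjD !adj_congr !adj_congdiag. Qed.

Let sformX b v : complex.Re (sform (X b) v v) =
  complex.Re (sform (congdiag G1 d1 b) (v *m T1) (v *m T1)) +
  complex.Re (sform (congdiag G2 d2 b) (v *m T2) (v *m T2)).
Proof. by rewrite /X sformD !sform_congr ReD. Qed.

(** Congruence by [Hi = G^-1 diag(d^(-s/2))] turns [congdiag G d b] into [diag(d^(b-s))]: the mean
    at [s] becomes the identity, and the mean at [t] the square of the mean at [m]. This is the
    situation of [loew_of_block]. *)
Lemma transformer_midpoint s t m : m = (s + t) / 2 ->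
  loew (X s) (congdiag G d s) -> loew (X t) (congdiag G d t) ->
  loew (X m) (congdiag G d m).
Proof.
move=> mE Hs Ht.
pose E : 'M[C]_k := rdiag (\row_i (d 0 i `^ (- (s / 2)))).
pose F : 'M[C]_k := rdiag (\row_i (d 0 i `^ (s / 2))).
pose Hi := invmx G *m E; pose H := F *m G.
have HiH : Hi *m H = 1%:M.
  rewrite /Hi /H mulmxA -(mulmxA (invmx G)) rdiagM (_ : \row_i _ = const_mx 1).
    by rewrite rdiag1 mulmx1 mulVmx.
  by apply/rowP => i; rewrite !mxE -powRD_gt0 // addNr powRr0.
have HcH b : adj Hi *m congdiag G d b *m Hi = rdiag (\row_i (d 0 i `^ (b - s))).
  rewrite congdiagE /Hi adjM adj_rdiag !mulmxA.
  rewrite -(mulmxA E) -adjM (mulmxV uG) adjmx1 mulmx1 -(mulmxA _ G) (mulmxV uG) mulmx1.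
  rewrite !rdiagM; congr rdiag; apply/rowP => i; rewrite !mxE.
  by rewrite -!powRD_gt0 //; congr (_ `^ _); field.
have key : loew (adj Hi *m X m *m Hi) (adj Hi *m congdiag G d m *m Hi).
  rewrite HcH; apply: loew_of_block.
  - by rewrite adj_congrl adjX.
  - by move=> i; rewrite mxE powR_ge0.
  move=> u v; set u' := u *m adj Hi; set v' := v *m adj Hi.
  have -> : sform 1%:M u u = sform (congdiag G d s) u' u'.
    rewrite -sform_congrl HcH subrr (_ : \row_i _ = const_mx 1) ?rdiag1 //.
    by apply/rowP => i; rewrite !mxE powRr0.
  have -> : sform (rdiag (\row_i ((\row_j d 0 j `^ (m - s)) 0 i ^+ 2))) v v =
     sform (congdiag G d t) v' v'.
    rewrite -sform_congrl HcH; congr sform; congr rdiag.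
    apply/rowP => i; rewrite !mxE expr2 -powRD_gt0 //; congr (_ `^ _).
    by rewrite mE; field.
  rewrite !sform_congrl -/u' -/v'.
  (* The block form with [X s] and [X t] on the diagonal is a sum of two nonnegative ones; replacing
     these diagonal entries by the larger means only increases it. *)
  have h1 := congdiag_block G1 (u' *m T1) (v' *m T1) d10 mE.
  have h2 := congdiag_block G2 (u' *m T2) (v' *m T2) d20 mE.
  have h3 := loew_sform u' Hs; have h4 := loew_sform v' Ht.
  have Xm x y : sform (X m) x y = sform (congdiag G1 d1 m) (x *m T1) (y *m T1) +
      sform (congdiag G2 d2 m) (x *m T2) (y *m T2).
    by rewrite /X sformD !sform_congr.
  rewrite sformX in h3; rewrite sformX in h4.
  move: h1 h2 h3 h4; rewrite !Xm !ReD.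
  do 12?[match goal with |- context [complex.Re ?z] => generalize (complex.Re z) end].
  by move=> *; lra.
have := loew_congrl H key.
by rewrite !(congrl_cancel _ HiH).
Qed.

Let cont_sform j (K : 'M[C]_j) (e : 'rV[R]_j) v : (forall i, 0 < e 0 i) ->
  continuous (fun b => complex.Re (sform (congdiag K e b) v v)).
Proof.
move=> e0 b; pose c i := complex.Re ((v *m adj K) 0 i * ((v *m adj K) 0 i)^*).
rewrite (_ : (fun b => _) = fun b => \sum_i e 0 i `^ b * c i); last first.
  by apply/funext => x; rewrite sform_congdiag Re_sum; apply: eq_bigr => i _; rewrite ReZ.
apply: cvg_big; first exact: add_continuous.
move=> i _; apply: cvgM; last exact: cvg_cst.
rewrite /powR gt_eqF //.
apply: continuous_comp; last exact: continuous_expR.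
by apply: cvgM; [exact: cvg_id|exact: cvg_cst].
Qed.

(** The two hypotheses are the cases [b = 0] and [b = 1]; midpoints and continuity in [b] give the
    rest. *)
Lemma transformer_congdiag b : 0 <= b <= 1 ->
  loew (T1 *m (adj G1 *m G1) *m adj T1 + T2 *m (adj G2 *m G2) *m adj T2)
       (adj G *m G) ->
  loew (T1 *m (adj G1 *m rdiag d1 *m G1) *m adj T1 +
        T2 *m (adj G2 *m rdiag d2 *m G2) *m adj T2) (adj G *m rdiag d *m G) ->
  loew (T1 *m congdiag G1 d1 b *m adj T1 + T2 *m congdiag G2 d2 b *m adj T2)
       (congdiag G d b).
Proof.
move=> b01 H0 H1; rewrite -/(X b).
pose S := [set b | loew (X b) (congdiag G d b)].
have S0 : S 0 by rewrite /S /X /= !congdiag0.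
have S1 : S 1 by rewrite /S /X /= !congdiag1.
apply: loewE; [exact: adjX|exact: adj_congdiag|move=> v].
pose phi c := complex.Re (sform (congdiag G d c) v v) -
  (complex.Re (sform (congdiag G1 d1 c) (v *m T1) (v *m T1)) +
   complex.Re (sform (congdiag G2 d2 c) (v *m T2) (v *m T2))).
have phiE c : phi c = complex.Re (sform (congdiag G d c) v v) -
    complex.Re (sform (X c) v v).
  by rewrite sformX.
rewrite -subr_ge0 -phiE leNgt; apply/negP => phi0.
have cphi : {for b, continuous phi}.
  apply: cvgB; first exact: cont_sform.
  by apply: cvgD; apply: cont_sform.
have /cvgrPdist_lt /(_ (- phi b)) := cphi; rewrite oppr_gt0 => /(_ phi0).
move=> /nbhs_ballP[e /= e0 he].
(* A negative value of [phi] at [b] would persist on a ball around [b], and that ball meets [S],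
   where [phi] is nonnegative. *)
have [a Sa ab] := midpoint_dense S0 S1 (fun s t => transformer_midpoint (erefl _)) b01 e0.
have := he a ab; rewrite /= distrC => /ltr_normlP[_].
rewrite ltrBlDr addNr ltNge phiE subr_ge0 => /negP; apply.
exact: (loew_sform v (Sa : loew (X a) (congdiag G d a))).
Qed.

End Transformer.
End Mean.

(** * The weighted geometric mean *)

Section GeometricMean.
Variable R : realType.
Local Notation C := (R[i]).

Lemma adj_invmx k (A : 'M[C]_k) : adj (invmx A) = invmx (adj A).
Proof. by rewrite /adj trmx_inv map_invmx. Qed.

Lemma adj_unitmx k (A : 'M[C]_k) : A \in unitmx -> adj A \in unitmx.
Proof. by move=> uA; rewrite /adj map_unitmx unitmx_tr. Qed.

Lemma decomp_unit_gt0 k (A : 'M[C]_k) U d : psd_decomp A (U, d) ->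
  A \in unitmx -> forall i, 0 < d 0 i.
Proof.
move=> [/= uU [d0 ->]] + i; rewrite !unitmx_mul => /andP[/andP[_ +] _].
rewrite unitmxE det_diag unitfE => /prodf_neq0 /(_ i isT).
by rewrite mxE lt_def d0 andbT; apply: contra_neq => ->.
Qed.

Lemma decomp_gt0_unit k (A : 'M[C]_k) U d : psd_decomp A (U, d) ->
  (forall i, 0 < d 0 i) -> A \in unitmx.
Proof.
move=> [/= uU [_ ->]] d0; have uU' := unitarymx_unit uU.
rewrite 2!unitmx_mul (adj_unitmx uU') uU' andbT /=.
rewrite unitmxE det_diag unitfE; apply/prodf_neq0 => i _.
by rewrite mxE; apply: contraTneq (d0 i) => /complexI ->; rewrite ltxx.
Qed.

Lemma psd_add_scalar k (A : 'M[C]_k) (e : R) : psd A -> 0 <= e ->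
  psd (A + (toC e)%:M).
Proof. by move=> pA e0; apply: psdD pA _; apply: psd_scalar. Qed.

Lemma psd_add_scalar_unit k (A : 'M[C]_k) (e : R) : psd A -> 0 < e ->
  A + (toC e)%:M \in unitmx.
Proof.
move=> pA e0; have [[U d] h] := psd_has_decomp (psd_add_scalar pA (ltW e0)).
have uU : U \is unitarymx by case: h.
apply: (decomp_gt0_unit h) => i; rewrite -ltcR -[(d 0 i)%:C%C]/(toC (d 0 i)).
have /= eA' := psd_decomp_rdiag h.
rewrite -(sform_row_unitary d i uU) -eA' sformD.
have -> : sform (toC e)%:M (row i U) (row i U) = toC e.
  have := sform_row_unitary (const_mx e) i uU.
  by rewrite rdiag_scalar -mulmxA -scalar_mxC mulmxA (unitary_adjl uU) mul1mx mxE.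
by apply: ltr_wpDl; [exact: psd_sform|rewrite ltcR].
Qed.

Lemma mxpow_half k (A : 'M[C]_k) : psd A ->
  adj (mxpow A 2^-1) = mxpow A 2^-1 /\ mxpow A 2^-1 *m mxpow A 2^-1 = A.
Proof.
move=> /psd_has_decomp[[U d] h]; rewrite (mxpow_decomp _ h).
have /= eA := psd_decomp_rdiag h; case: h => /= uU [d0 _].
split; first by rewrite adj_congrl adj_rdiag.
rewrite [RHS]eA !mulmxA -(mulmxA _ U) (unitary_adjr uU) mulmx1.
rewrite -(mulmxA (adj U)) rdiagM; congr (_ *m rdiag _ *m _).
by apply/rowP => i; rewrite !mxE powR12_sqrt // -expr2 sqr_sqrtr.
Qed.

(** With [H = A_e^(1/2)] and [U^* diag(d) U] a spectral decomposition of [H^-1 B_e H^-1], take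
    [G = U H]. One pair [G], [d] serves all exponents. *)
Lemma gm_eps_congdiag k (A B : 'M[C]_k) (e : R) : psd A -> psd B -> 0 < e ->
  exists (G : 'M[C]_k) (d : 'rV[R]_k), [/\ G \in unitmx,
    forall i, 0 < d 0 i,
    A + (toC e)%:M = adj G *m G,
    B + (toC e)%:M = adj G *m rdiag d *m G &
    forall b, gm_eps b A B e = congdiag G d b].
Proof.
move=> pA pB e0; have [hH HH] := mxpow_half (psd_add_scalar pA (ltW e0)).
have uA := psd_add_scalar_unit pA e0; have uB := psd_add_scalar_unit pB e0.
have pBe := psd_add_scalar pB (ltW e0).
rewrite /gm_eps; set H := mxpow _ _ in hH HH *; move: pBe uB uA HH.
set Ae := A + _; set Be := B + _ => pBe uB uA HH.
have uH : H \in unitmx by move: uA; rewrite -HH unitmx_mul => /andP[].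
have hHi : adj (invmx H) = invmx H by rewrite adj_invmx hH.
have pD : psd (invmx H *m Be *m invmx H).
  by rewrite -{2}hHi; apply: psd_congr.
have uD : invmx H *m Be *m invmx H \in unitmx.
  by rewrite !unitmx_mul !unitmx_inv uH uB.
have [[U d] h] := psd_has_decomp pD.
have d0 := decomp_unit_gt0 h uD; have /= eD := psd_decomp_rdiag h.
have uU : U \is unitarymx by case: h.
exists (U *m H), d; split.
- by rewrite unitmx_mul unitarymx_unit.
- exact: d0.
- by rewrite adjM hH mulmxA -(mulmxA H) (unitary_adjl uU) mulmx1 HH.
- have -> : adj (U *m H) *m rdiag d *m (U *m H) = H *m (adj U *m rdiag d *m U) *m H.
    by rewrite adjM hH !mulmxA.
  rewrite -eD.
  by rewrite !mulmxA (mulmxV uH) mul1mx -mulmxA (mulVmx uH) mulmx1.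
- by move=> b; rewrite (mxpow_decomp _ h) congdiagE adjM hH !mulmxA.
Qed.

(** The regularizations [e] and [e'] may differ: this gives monotonicity in [e], and allows [T T^*]
    to exceed the identity. *)
Lemma gm_eps_transformer k l (T1 T2 : 'M[C]_(k, l)) (A B : 'M[C]_k)
    (A1 B1 A2 B2 : 'M[C]_l) b (e e' : R) :
  0 <= b <= 1 -> 0 < e -> 0 < e' ->
  psd A -> psd B -> psd A1 -> psd B1 -> psd A2 -> psd B2 ->
  loew (T1 *m (A1 + (toC e')%:M) *m adj T1 + T2 *m (A2 + (toC e')%:M) *m adj T2)
       (A + (toC e)%:M) ->
  loew (T1 *m (B1 + (toC e')%:M) *m adj T1 + T2 *m (B2 + (toC e')%:M) *m adj T2)
       (B + (toC e)%:M) ->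
  loew (T1 *m gm_eps b A1 B1 e' *m adj T1 + T2 *m gm_eps b A2 B2 e' *m adj T2)
       (gm_eps b A B e).
Proof.
move=> b01 e0 e'0 pA pB pA1 pB1 pA2 pB2.
have [G [d [uG d0 -> -> ->]]] := gm_eps_congdiag pA pB e0.
have [G1 [d1 [uG1 d10 -> -> ->]]] := gm_eps_congdiag pA1 pB1 e'0.
have [G2 [d2 [uG2 d20 -> -> ->]]] := gm_eps_congdiag pA2 pB2 e'0.
exact: transformer_congdiag.
Qed.

Lemma gm_eps_le k (A B : 'M[C]_k) b (e e' : R) : 0 <= b <= 1 ->
  psd A -> psd B -> 0 < e -> e <= e' -> loew (gm_eps b A B e) (gm_eps b A B e').
Proof.
move=> b01 pA pB e0 ee'; have e'0 := lt_le_trans e0 ee'.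
(* Instance [T1 = 1], [T2 = 0], with both pairs of matrices equal to [A], [B]. *)
have H (Z : 'M[C]_k) : loew (1%:M *m (Z + (toC e)%:M) *m adj 1%:M +
    0 *m (Z + (toC e)%:M) *m adj 0) (Z + (toC e')%:M).
  rewrite mul1mx adjmx1 mulmx1 !mul0mx addr0 /loew opprD addrACA subrr add0r.
  by rewrite -raddfB -toCB; apply: psd_scalar; rewrite subr_ge0.
have := gm_eps_transformer b01 e'0 e0 pA pB pA pB pA pB (H A) (H B).
by rewrite mul1mx adjmx1 mulmx1 !mul0mx addr0.
Qed.

Lemma psd_gm_eps k (A B : 'M[C]_k) b (e : R) :
  psd A -> psd B -> 0 < e -> psd (gm_eps b A B e).
Proof.
move=> pA pB e0; have [G [d [uG d0 _ _ ->]]] := gm_eps_congdiag pA pB e0.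
by rewrite congdiagE; apply/psd_congrl/psd_rdiag => i; rewrite mxE powR_ge0.
Qed.

Lemma sform_delta k (A : 'M[C]_k) i j :
  sform A (delta_mx 0 i) (delta_mx 0 j) = A i j.
Proof.
rewrite sformE; have -> : adj (delta_mx 0 j : 'rV[C]_k) = delta_mx j 0.
  by apply/matrixP => x y; rewrite adjE !mxE rmorph_nat andbC.
by rewrite -rowE -colE !mxE.
Qed.

(** Polarization. Monotonicity yields convergence of quadratic forms, whereas [gmean] is an
    entrywise limit; this identity passes from the former to the latter. *)
Lemma herm_Re_entry k (A : 'M[C]_k) i j : adj A = A ->
  complex.Re (A i j) = 2^-1 *
   (complex.Re (sform A (delta_mx 0 i + delta_mx 0 j) (delta_mx 0 i + delta_mx 0 j)) -
    complex.Re (sform A (delta_mx 0 i) (delta_mx 0 i)) -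
    complex.Re (sform A (delta_mx 0 j) (delta_mx 0 j))).
Proof.
move=> hA; have Aji : A j i = (A i j)^* by rewrite -{1}hA adjE.
by rewrite !sformDl !sformDr !sform_delta !ReD Aji Re_conjc; field.
Qed.

Lemma herm_Im_entry k (A : 'M[C]_k) i j : adj A = A ->
  complex.Im (A i j) = 2^-1 *
   (complex.Re (sform A (delta_mx 0 i + 'i%C *: delta_mx 0 j)
                        (delta_mx 0 i + 'i%C *: delta_mx 0 j)) -
    complex.Re (sform A (delta_mx 0 i) (delta_mx 0 i)) -
    complex.Re (sform A (delta_mx 0 j) (delta_mx 0 j))).
Proof.
move=> hA; have Aji : A j i = (A i j)^* by rewrite -{1}hA adjE.
rewrite !sformDl !sformDr !sformZl !sformZr !sform_delta !ReD Aji !conjE.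
by case: (A i j) (A i i) (A j j) => [a b] [c d] [p q] /=; field.
Qed.

Section Limit.
Variables (k : nat) (A B : 'M[C]_k) (b : R).
Hypotheses (b01 : 0 <= b <= 1) (pA : psd A) (pB : psd B).
Local Notation g e := (gm_eps b A B e).

(** The form is nondecreasing in [e] and bounded below by 0. That the limit is an infimum is what
    [loew_gmeanP] exploits. *)
Lemma gm_eps_form_cvg v : (fun e => complex.Re (sform (g e) v v)) @ (0:R)^'+ -->
  inf [set complex.Re (sform (g e) v v) | e in [set` `]0, +oo[]].
Proof.
apply: nondecreasing_at_right_cvgr => //.
  move=> x y; rewrite !in_itv /= !andbT => x0 y0 xy.
  exact/loew_sform/gm_eps_le.
exists 0 => _ [e + <-]; rewrite /= in_itv /= andbT => e0.
exact/sform_psd_ge0/psd_gm_eps.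
Qed.

Let form_cvg v : cvg ((fun e => complex.Re (sform (g e) v v)) @ (0:R)^'+).
Proof. by apply/cvg_ex; eexists; exact: gm_eps_form_cvg. Qed.

Let near_herm : \forall e \near (0:R)^'+, adj (g e) = g e.
Proof.
by near=> e; apply: (psd_gm_eps b pA pB _).1; near: e; exact: nbhs_right_gt.
Unshelve. all: by end_near. Qed.

Let Re_cvg i j : cvg ((fun e => complex.Re (g e i j)) @ (0:R)^'+).
Proof.
pose f v e := complex.Re (sform (g e) v v).
have h : cvg ((fun e => 2^-1 * (f (delta_mx 0 i + delta_mx 0 j) e -
   f (delta_mx 0 i) e - f (delta_mx 0 j) e)) @ (0:R)^'+).
  apply: is_cvgM; first exact: is_cvg_cst.
  by apply: is_cvgB; first apply: is_cvgB; apply: form_cvg.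
apply/cvg_ex; exists (lim ((fun e => 2^-1 * (f (delta_mx 0 i + delta_mx 0 j) e -
   f (delta_mx 0 i) e - f (delta_mx 0 j) e)) @ (0:R)^'+)).
(* Polarization needs [g e] Hermitian; having this for small positive [e] is enough for a right
   limit at 0. *)
apply: cvg_trans h; apply: near_eq_cvg.
by apply: filterS near_herm => e he; rewrite (herm_Re_entry i j he).
Qed.

Let Im_cvg i j : cvg ((fun e => complex.Im (g e i j)) @ (0:R)^'+).
Proof.
pose f v e := complex.Re (sform (g e) v v).
have h : cvg ((fun e => 2^-1 * (f (delta_mx 0 i + 'i%C *: delta_mx 0 j) e -
   f (delta_mx 0 i) e - f (delta_mx 0 j) e)) @ (0:R)^'+).
  apply: is_cvgM; first exact: is_cvg_cst.
  by apply: is_cvgB; first apply: is_cvgB; apply: form_cvg.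
apply/cvg_ex; exists (lim ((fun e => 2^-1 * (f (delta_mx 0 i + 'i%C *: delta_mx 0 j) e -
   f (delta_mx 0 i) e - f (delta_mx 0 j) e)) @ (0:R)^'+)).
apply: cvg_trans h; apply: near_eq_cvg.
by apply: filterS near_herm => e he; rewrite (herm_Im_entry i j he).
Qed.

Lemma Re_gmean i j : complex.Re (gmean b A B i j) =
  lim ((fun e => complex.Re (g e i j)) @ (0:R)^'+).
Proof. by rewrite mxE /= !mulr0 !mul0r subrr addr0. Qed.

Lemma Im_gmean i j : complex.Im (gmean b A B i j) =
  lim ((fun e => complex.Im (g e i j)) @ (0:R)^'+).
Proof. by rewrite mxE /= mulr1 mul0r addr0 add0r. Qed.

Lemma adj_gmean : adj (gmean b A B) = gmean b A B.
Proof.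
have entry i j e : adj (g e) = g e -> g e j i = (g e i j)^*.
  by move=> he; rewrite -{1}he adjE.
apply/matrixP => i j; rewrite adjE; apply/eqP; rewrite eq_complex.
apply/andP; split; apply/eqP.
  rewrite Re_conjc !Re_gmean; apply/cvg_lim => //.
  apply: cvg_trans (Re_cvg (i := i) (j := j)); apply: near_eq_cvg.
  by apply: filterS near_herm => e /(entry i j) ->; rewrite Re_conjc.
rewrite Im_conjc !Im_gmean -limN; last exact: Im_cvg.
apply/esym/cvg_lim => //; apply: cvg_trans (is_cvgN (Im_cvg (i := j) (j := i))).
apply: near_eq_cvg.
by apply: filterS near_herm => e /(entry j i) ->; rewrite Im_conjc.
Qed.

(** A finite real combination of the real and imaginary parts of the entries, through which the
    entrywise limits pass. *)
Lemma Re_sform_entries (X : 'M[C]_k) v : complex.Re (sform X v v) =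
  \sum_i \sum_j (complex.Re (v 0 i * (v 0 j)^*) * complex.Re (X i j) -
                 complex.Im (v 0 i * (v 0 j)^*) * complex.Im (X i j)).
Proof.
rewrite sform_sum Re_sum; apply: eq_bigr => i _; rewrite Re_sum.
by apply: eq_bigr => j _; rewrite mulrAC; case: (_ * _^*) (X i j) => [? ?] [].
Qed.

Lemma gmean_form v : complex.Re (sform (gmean b A B) v v) =
  lim ((fun e => complex.Re (sform (g e) v v)) @ (0:R)^'+).
Proof.
apply/esym/cvg_lim => //; rewrite Re_sform_entries.
under eq_fun do rewrite Re_sform_entries.
apply: cvg_big => [|i _]; first exact: add_continuous.
apply: cvg_big => [|j _]; first exact: add_continuous.
rewrite Re_gmean Im_gmean.
apply: cvgB; apply: cvgM; [exact: cvg_cst|exact: Re_cvg|exact: cvg_cst|exact: Im_cvg].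
Qed.

(** The forms of the mean are infima over [e > 0] of those of the regularized means. Every later
    inequality involving [gmean] is reduced to positive definite arguments by this equivalence. *)
Lemma loew_gmeanP (Y : 'M[C]_k) :
  loew Y (gmean b A B) <-> forall e, 0 < e -> loew Y (gm_eps b A B e).
Proof.
split=> [YG e e0|H].
  have hg := (psd_gm_eps b pA pB e0).1.
  have hY : adj Y = Y.
    by have := YG.1; rewrite adjB adj_gmean => /addrI/oppr_inj.
  apply: loewE => // v; apply: le_trans (loew_sform v YG) _.
  rewrite gmean_form (cvg_lim _ (gm_eps_form_cvg (v := v))) //.
  apply: ge_inf; last by exists e => //=; rewrite in_itv /= e0.
  exists 0 => _ [x + <-]; rewrite /= in_itv /= andbT => x0.
  exact/sform_psd_ge0/psd_gm_eps.
have hY : adj Y = Y.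
  have := (H 1 ltr01).1; rewrite adjB (psd_gm_eps b pA pB ltr01).1.
  by move=> /addrI/oppr_inj.
apply: loewE => // [|v]; first exact: adj_gmean.
rewrite gmean_form; apply: limr_ge; first exact: form_cvg.
by near=> e; apply/loew_sform/H; near: e; exact: nbhs_right_gt.
Unshelve. all: by end_near. Qed.

End Limit.
End GeometricMean.

(** * Feasible sets, partial traces and the operator norm *)

Section Feasibility.
Variable R : realType.
Local Notation C := (R[i]).

Lemma loew_congdiag_unitary k (U : 'M[C]_k) (d e : 'rV[R]_k) :
  (forall i, d 0 i <= e 0 i) ->
  loew (adj U *m rdiag d *m U) (adj U *m rdiag e *m U).
Proof.
move=> de; apply: loew_congrl; rewrite /loew.
have -> : rdiag e - rdiag d = rdiag (\row_i (e 0 i - d 0 i)).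
  by apply/matrixP => i j; rewrite !mxE toCB -mulrnBl.
by apply: psd_rdiag => i; rewrite mxE subr_ge0.
Qed.

Lemma unitary_scalar k (U : 'M[C]_k) (r : R) : U \is unitarymx ->
  adj U *m rdiag (const_mx r) *m U = (toC r)%:M.
Proof.
by move=> uU; rewrite rdiag_scalar -mulmxA -scalar_mxC mulmxA (unitary_adjl uU) mul1mx.
Qed.

Lemma psd_bounded k (A : 'M[C]_k) : psd A ->
  exists2 c : R, 0 < c & loew A (toC c)%:M.
Proof.
move=> /psd_has_decomp[[U d] h].
have /= eA := psd_decomp_rdiag h; case: h => /= uU [d0 _].
(* The sum dominates each eigenvalue, and the 1 makes the constant positive. *)
exists (1 + \sum_i d 0 i); first by rewrite ltr_pwDl // sumr_ge0.
rewrite -(unitary_scalar _ uU) eA; apply: loew_congdiag_unitary => i.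
rewrite mxE (bigD1 i) //= addrCA lerDl addr_ge0 // sumr_ge0 //.
Qed.

(** If [T T^* <= c I], then [T (Z + (e/c) I) T^* <= T Z T^* + e I]. So the regularized inequality
    applies with [e/c] on the inner side, for any rectangular [T]. *)
Lemma loew_gmean_congr k l (T : 'M[C]_(k, l)) (rho sigma A : 'M[C]_l) b :
  0 <= b <= 1 -> psd sigma -> psd A -> loew rho (gmean b sigma A) ->
  loew (T *m rho *m adj T) (gmean b (T *m sigma *m adj T) (T *m A *m adj T)).
Proof.
move=> b01 ps pA /(loew_gmeanP b01 ps pA) H.
have ps' := psd_congr T ps; have pA' := psd_congr T pA.
apply/(loew_gmeanP b01 ps' pA') => e e0.
have [c c0 hc] : exists2 c : R, 0 < c & loew (T *m adj T) (toC c)%:M.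
  by apply: psd_bounded; rewrite -{1}(adjK T); apply: psd_gram.
have ec0 : 0 < e / c by rewrite divr_gt0.
have HT (Z : 'M[C]_l) : loew (T *m (Z + (toC (e / c))%:M) *m adj T +
    0 *m (Z + (toC (e / c))%:M) *m adj 0) (T *m Z *m adj T + (toC e)%:M).
  rewrite !mul0mx addr0 mulmxDr mulmxDl; apply: loewD; first exact: loew_refl.
  rewrite mul_mx_scalar -scalemxAl /loew.
  have -> : (toC e)%:M = toC (e / c) *: (toC c)%:M :> 'M[C]_k.
    by rewrite scale_scalar_mx -toCM divfK // gt_eqF.
  by rewrite -scalerBr; apply: psdZ => //; apply: ltW.
have := gm_eps_transformer b01 e0 ec0 ps' pA' ps pA ps pA (HT sigma) (HT A).
rewrite !mul0mx addr0; apply: loew_trans; apply: loew_congr; exact: H.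
Qed.

Lemma scalar_congr k (s : R) (A : 'M[C]_k) :
  (toC s)%:M *m A *m adj (toC s)%:M = toC (s ^+ 2) *: A.
Proof. by rewrite adj_scalar mul_scalar_mx mul_mx_scalar scalerA -toCM. Qed.

(** Joint concavity of the mean, from the scalar matrices [sqrt t] and [sqrt (1 - t)]; [sigma],
    [rho] and the regularization are convex combinations of themselves. *)
Lemma loew_gmean_convex k (rho sigma A1 A2 : 'M[C]_k) b t :
  0 <= b <= 1 -> 0 <= t <= 1 -> psd sigma -> psd A1 -> psd A2 ->
  loew rho (gmean b sigma A1) -> loew rho (gmean b sigma A2) ->
  loew rho (gmean b sigma (toC t *: A1 + toC (1 - t) *: A2)).
Proof.
move=> b01 /andP[t0 t1] ps p1 p2 /(loew_gmeanP b01 ps p1) H1.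
move=> /(loew_gmeanP b01 ps p2) H2.
have t1' : 0 <= 1 - t by rewrite subr_ge0.
have pA : psd (toC t *: A1 + toC (1 - t) *: A2) by apply: psdD; apply: psdZ.
apply/(loew_gmeanP b01 ps pA) => e e0.
have HT (Z1 Z2 Z : 'M[C]_k) : Z = toC t *: Z1 + toC (1 - t) *: Z2 ->
    (toC (Num.sqrt t))%:M *m Z1 *m adj (toC (Num.sqrt t))%:M +
    (toC (Num.sqrt (1 - t)))%:M *m Z2 *m adj (toC (Num.sqrt (1 - t)))%:M = Z.
  by move=> ->; rewrite !scalar_congr !sqr_sqrtr.
have HC (Z : 'M[C]_k) : Z = toC t *: Z + toC (1 - t) *: Z.
  by rewrite -scalerDl -toCD subrKC toC1 scale1r.
have := @gm_eps_transformer _ _ _ (toC (Num.sqrt t))%:M (toC (Num.sqrt (1 - t)))%:M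
  _ _ _ _ _ _ b _ _ b01 e0 e0 ps pA ps p1 ps p2.
rewrite (HT _ _ _ (HC _)).
rewrite (HT _ _ (toC t *: A1 + toC (1 - t) *: A2 + (toC e)%:M)); last first.
  by rewrite !scalerDr addrACA -HC.
move=> /(_ (loew_refl _) (loew_refl _)); apply: loew_trans.
by rewrite -(HT _ _ _ (HC rho)); apply: loewD; apply: loew_congr; [apply: H1|apply: H2].
Qed.

(** * Traces, tensor products and the Choi operator *)

Lemma psd_tr_ge0 k (A : 'M[C]_k) : psd A -> 0 <= \tr A.
Proof.
move=> pA; apply: sumr_ge0 => i _; rewrite -sform_delta; exact: psd_sform.
Qed.

(** By cyclicity the trace is that of [A^(1/2) B A^(1/2)]. *)
Lemma psd_tr_mul_ge0 k (A B : 'M[C]_k) : psd A -> psd B -> 0 <= \tr (A *m B).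
Proof.
move=> pA pB; have [hH HH] := mxpow_half pA.
rewrite -HH -mulmxA mxtrace_mulC -mulmxA -{2}hH mulmxA.
exact/psd_tr_ge0/psd_congr.
Qed.

Lemma adj_tens k l p q (A : 'M[C]_(k, l)) (B : 'M[C]_(p, q)) :
  adj (A *t B) = adj A *t adj B.
Proof. by rewrite /adj trmx_tens map_mxT. Qed.

Lemma tens1mx1 n m : (1%:M : 'M[C]_n) *t (1%:M : 'M[C]_m) = 1%:M.
Proof.
apply/matrixP => i j; case: (mxtens_indexP i) (mxtens_indexP j) => x y [x' y'].
rewrite tensmxE !mxE -natrM mulnb (can_eq (@mxtens_indexK n m)).
by rewrite xpair_eqE.
Qed.

Lemma big_mxtens n m (F : 'I_(n * m) -> C) :
  \sum_k F k = \sum_i \sum_j F (mxtens_index (i, j)).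
Proof.
rewrite (reindex (@mxtens_index n m)) /=; last first.
  by apply: onW_bij; exists (@mxtens_unindex n m);
    [exact: mxtens_indexK|exact: mxtens_unindexK].
by rewrite pair_big; apply: eq_bigr => -[].
Qed.

Lemma tr_tens_ptrY n m (X : 'M[C]_n) (A : 'M[C]_(n * m)) :
  \tr ((X *t (1%:M : 'M[C]_m)) *m A) = \tr (X *m ptrY A).
Proof.
rewrite /mxtrace big_mxtens; apply: eq_bigr => i _.
rewrite [RHS]mxE; under eq_bigr do rewrite mxE big_mxtens.
rewrite exchange_big; apply: eq_bigr => i' _ /=.
rewrite mxE mulr_sumr; apply: eq_bigr => j _.
rewrite (bigD1 j) //= big1 ?addr0 => [|j' jj'].
  by rewrite tensmxE mxE eqxx mulr1.
by rewrite tensmxE mxE eq_sym (negbTE jj') mulr0 mul0r.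
Qed.

Lemma ptrYD n m (A B : 'M[C]_(n * m)) : ptrY (A + B) = ptrY A + ptrY B.
Proof.
apply/matrixP => i j; rewrite !mxE -big_split.
by apply: eq_bigr => x _; rewrite mxE.
Qed.

Lemma ptrYZ n m c (A : 'M[C]_(n * m)) : ptrY (c *: A) = c *: ptrY A.
Proof.
apply/matrixP => i j; rewrite !mxE mulr_sumr.
by apply: eq_bigr => x _; rewrite mxE.
Qed.

Lemma psd_sum k I (r : seq I) (P : pred I) (F : I -> 'M[C]_k) :
  (forall i, psd (F i)) -> psd (\sum_(i <- r | P i) F i).
Proof. by move=> pF; apply: (big_ind (@psd R k)) => //; [exact: psd0|exact: psdD]. Qed.

Lemma psd_ptrY n m (A : 'M[C]_(n * m)) : psd A -> psd (ptrY A).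
Proof.
(* Kraus form of the partial trace: [E j] is the identity tensored with the [j]-th basis row
   vector. *)
move=> pA; pose E j : 'M[C]_(n, n * m) := \matrix_i delta_mx 0 (mxtens_index (i, j)).
have -> : ptrY A = \sum_j E j *m A *m adj (E j).
  apply/matrixP => i i'; rewrite mxE summxE; apply: eq_bigr => j _.
  have -> : (E j *m A *m adj (E j)) i i' = sform A (row i (E j)) (row i' (E j)).
    rewrite sformE -row_mul mxE [RHS]mxE; apply: eq_bigr => x _.
    by rewrite !adjE !mxE.
  by rewrite !rowK sform_delta.
by apply: psd_sum => j; apply: psd_congr.
Qed.

Lemma psd_choi n m (N : 'M[C]_n -> 'M[C]_m) : completely_positive N -> psd (choi N).
Proof.
move=> cpN.
(* The unnormalized maximally entangled vector; [w^* w] is the operator Phi. *)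
pose w : 'rV[C]_(n * n) := \row_k ((mxtens_unindex k).1 == (mxtens_unindex k).2)%:R.
have -> : choi N = idtens N (adj w *m w).
  apply: eq_bigr => x _; apply: eq_bigr => x' _; congr (_ *t N _).
  apply/matrixP => a b; rewrite !mxE big_ord1 adjE !mxE !mxtens_indexK /=.
  by rewrite rmorph_nat -natrM mulnb !(eq_sym x) !(eq_sym x').
by apply: cpN; apply: psd_gram.
Qed.

(** * The operator norm of positive semidefinite matrices *)

Lemma vnormE k (v : 'cV[C]_k) :
  vnorm v = Num.sqrt (complex.Re (sform 1%:M (adj v) (adj v))).
Proof.
rewrite /vnorm sformE mulmx1 adjK mxE Re_sum; congr Num.sqrt.
apply: eq_bigr => i _; rewrite adjE conjE; case: (v i 0) => a b /=.
by rewrite !expr2 mulNr opprK.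
Qed.

Lemma vnorm_mul_herm k (A : 'M[C]_k) v : adj A = A ->
  vnorm (A *m v) = Num.sqrt (complex.Re (sform (A *m A) (adj v) (adj v))).
Proof. by move=> hA; rewrite vnormE adjM hA -sform_congr mulmx1 hA. Qed.

Lemma unitary_sqr k (U : 'M[C]_k) d : U \is unitarymx ->
  (adj U *m rdiag d *m U) *m (adj U *m rdiag d *m U) =
  adj U *m rdiag (\row_i (d 0 i ^+ 2)) *m U.
Proof.
move=> uU; rewrite !mulmxA -(mulmxA _ U) (unitary_adjr uU) mulmx1.
by rewrite -(mulmxA (adj U)) rdiagM; congr (_ *m rdiag _ *m _).
Qed.

(** Squaring is not monotone for the Loewner order in general, but a scalar bound passes to the
    eigenvalues of [B], so [B^2 <= r^2 I]. *)
Lemma vnorm_mul_le k (B : 'M[C]_k) (r : R) v : psd B -> loew B (toC r)%:M ->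
  0 <= r -> vnorm v = 1 -> vnorm (B *m v) <= r.
Proof.
move=> pB Br r0 v1; rewrite (vnorm_mul_herm _ pB.1).
have [[U d] h] := psd_has_decomp pB.
have /= eB := psd_decomp_rdiag h; case: h => /= uU [d0 _].
have dr i : d 0 i <= r.
  have := loew_sform (row i U) Br; rewrite {1}eB -(unitary_scalar _ uU).
  by rewrite !sform_row_unitary // mxE.
have BB : loew (B *m B) (toC (r ^+ 2))%:M.
  rewrite eB (unitary_sqr _ uU) -(unitary_scalar _ uU).
  by apply: loew_congdiag_unitary => i; rewrite !mxE ler_sqr ?nnegrE.
have v1' : complex.Re (sform 1%:M (adj v) (adj v)) = 1.
  move: v1; rewrite vnormE => /(congr1 (fun x => x ^+ 2)).
  by rewrite sqr_sqrtr ?expr1n //; apply/sform_psd_ge0/psd1.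
rewrite -[leRHS](ger0_norm r0) -sqrtr_sqr ler_wsqrtr //.
apply: le_trans (loew_sform (adj v) BB) _.
by rewrite -scalemx1 sformZ ReZ v1' mulr1.
Qed.

Lemma opnorm_le k (B : 'M[C]_k) (r : R) : (0 < k)%N -> psd B ->
  loew B (toC r)%:M -> 0 <= r -> opnorm B <= r.
Proof.
move=> k0 pB Br r0; apply: ge_sup => [|_ [v [v1 ->]]]; last exact: vnorm_mul_le.
(* The supremum must range over a nonempty set; [0 < k] supplies a basis vector of norm 1. *)
exists (vnorm (B *m delta_mx (Ordinal k0) 0)); exists (delta_mx (Ordinal k0) 0).
split=> //; rewrite /vnorm (bigD1 (Ordinal k0)) //= big1 ?addr0 => [|i i0].
  by rewrite mxE !eqxx /= expr1n expr0n /= addr0 sqrtr1.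
by rewrite mxE (negbTE i0) /= expr0n /= addr0.
Qed.

(** Each eigenvalue is the value of [vnorm (B *m v)] at a unit eigenvector, so it lies below the
    supremum. *)
Lemma loew_opnorm k (B : 'M[C]_k) : psd B -> loew B (toC (opnorm B))%:M.
Proof.
move=> pB; have [[U d] h] := psd_has_decomp pB.
have /= eB := psd_decomp_rdiag h; case: h => /= uU [d0 _].
rewrite {1}eB -(unitary_scalar _ uU); apply: loew_congdiag_unitary => i; rewrite mxE.
apply: ub_le_sup.
  have [c c0 Bc] := psd_bounded pB.
  by exists c => _ [v [v1 ->]]; apply: vnorm_mul_le => //; apply: ltW.
exists (adj (row i U)); split.
  rewrite vnormE adjK; have := sform_row_unitary (const_mx 1) i uU.
  by rewrite (unitary_scalar _ uU) mxE toC1 => ->; rewrite sqrtr1.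
rewrite (vnorm_mul_herm _ pB.1) adjK {1 2}eB (unitary_sqr _ uU).
by rewrite sform_row_unitary // mxE Re_toC sqrtr_sqr ger0_norm.
Qed.

Lemma tr_density_le_opnorm k (w B : 'M[C]_k) : density w -> psd B ->
  complex.Re (\tr (w *m B)) <= opnorm B.
Proof.
move=> [pw w1] pB; have := ge0_Re (psd_tr_mul_ge0 pw (loew_opnorm pB)).
rewrite mulmxBr mxtraceD raddfN /= ReD ReN subr_ge0.
by rewrite mul_mx_scalar mxtraceZ w1 mulr1.
Qed.

End Feasibility.

(** * Separation and minimax *)

Section Minimax.
Variable R : realType.
Local Notation C := (R[i]).

Section Separation.
Variables (I : finType) (T : set (I -> R)) (r : R).
Hypotheses (T0 : T !=set0).
Hypothesis Tconvex : forall x y t, T x -> T y -> 0 <= t <= 1 ->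
  T (fun i => t * x i + (1 - t) * y i).
Hypothesis Tr : forall x, T x -> r <= \sum_i x i ^+ 2.

Let sq (x : I -> R) := \sum_i x i ^+ 2.
Let d := inf [set sq x | x in T].

Let sq_ge0 x : 0 <= sq x.
Proof. by apply: sumr_ge0 => i _; exact: sqr_ge0. Qed.

Let T_lb : has_lbound [set sq x | x in T].
Proof. by exists 0 => _ [x _ <-]; apply: sq_ge0. Qed.

Let d_le x : T x -> d <= sq x.
Proof. by move=> Tx; apply: ge_inf => //; exists x. Qed.

Let r_le_d : r <= d.
Proof.
apply: lb_le_inf; first by case: T0 => x Tx; exists (sq x), x.
by move=> _ [x Tx <-]; apply: Tr.
Qed.

Let minimizing : {u : nat -> I -> R &
  forall n, T (u n) /\ sq (u n) < d + n.+1%:R^-1}.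
Proof.
apply: (@choice _ _ (fun n x => T x /\ sq x < d + n.+1%:R^-1)) => n.
have e0 : 0 < n.+1%:R^-1 :> R by rewrite invr_gt0.
have [|_ [x Tx <-] h] := @inf_adherent R [set sq x | x in T] _ e0.
  by split; [case: T0 => x Tx; exists (sq x), x|exact: T_lb].
by exists x.
Qed.

Let u := projT1 minimizing.
Let Tu n : T (u n) := (projT2 minimizing n).1.
Let u_lt n : sq (u n) < d + n.+1%:R^-1 := (projT2 minimizing n).2.

(* Parallelogram law: the midpoint of [u n] and [u m] is still in [T]. *)
Let u_dist n m i : (u n i - u m i) ^+ 2 <= 2 * (n.+1%:R^-1 + m.+1%:R^-1).
Proof.
have h : 0 <= (2^-1 : R) <= 1 by apply/andP; split; lra.
have := d_le (Tconvex (Tu n) (Tu m) h).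
have E : sq (fun i => 2^-1 * u n i + (1 - 2^-1) * u m i) =
    2^-1 * sq (u n) + 2^-1 * sq (u m) - 4^-1 * sq (fun i => u n i - u m i).
  rewrite /sq !mulr_sumr -big_split -sumrB /=.
  by apply: eq_bigr => j _; field.
rewrite E; have := u_lt n; have := u_lt m.
have : (u n i - u m i) ^+ 2 <= sq (fun i => u n i - u m i).
  by rewrite /sq (bigD1 i) //= lerDl; apply: sumr_ge0 => j _; exact: sqr_ge0.
move: (sq _) (sq _) (sq _) (_ ^+ 2) (n.+1%:R^-1) (m.+1%:R^-1) => *; lra.
Qed.

Let u_cvg i : cvg ((fun n => u n i) @ \oo).
Proof.
apply/cauchy_cvgP/cauchy_exP => e e0.
(* Chosen so that [u_dist] gives the bound [2 (e^2/4 + e^2/4) = e^2]. *)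
have e20 : 0 < e ^+ 2 / 4 by rewrite divr_gt0 ?exprn_gt0.
have [N _ hN] := near_infty_natSinv_lt (PosNum e20).
exists (u N i); exists N => // n /= Nn; rewrite /ball /=.
have h1 : N.+1%:R^-1 < e ^+ 2 / 4 := hN N (leqnn N).
have h2 : n.+1%:R^-1 < e ^+ 2 / 4 := hN n Nn.
rewrite -(ltr_pXn2r (n := 2)) ?nnegrE // ?ltW // real_normK ?num_real //.
apply: le_lt_trans (u_dist N n i) _; move: h1 h2.
by move: (N.+1%:R^-1) (n.+1%:R^-1) (e ^+ 2) => *; lra.
Qed.

Let h i := lim ((fun n => u n i) @ \oo).

Let sq_cvg x t : (fun n => sq (fun i => t * x i + (1 - t) * u n i)) @ \oo -->
  sq (fun i => t * x i + (1 - t) * h i).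
Proof.
apply: cvg_big => [|i _]; first exact: add_continuous.
under eq_fun do rewrite expr2.
rewrite expr2.
have H : (fun n => t * x i + (1 - t) * u n i) @ \oo --> t * x i + (1 - t) * h i.
  by apply: cvgD; [exact: cvg_cst|apply: cvgM; [exact: cvg_cst|exact: u_cvg]].
exact: cvgM.
Qed.

(** [T] is not assumed closed, so [h] may lie outside it; the bound on the segment from [h] to [x]
    is a limit of bounds on segments from [u n] to [x], which stay in [T]. *)
Let d_le_h x t : T x -> 0 <= t <= 1 -> d <= sq (fun i => t * x i + (1 - t) * h i).
Proof.
move=> Tx t01; rewrite -(cvg_lim _ (sq_cvg (x := x) (t := t))) //.
apply: limr_ge; first by apply/cvg_ex; eexists; exact: sq_cvg.
by apply: nearW => n; apply/d_le/Tconvex.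
Qed.

Let sq_h : sq h <= d.
Proof.
(* Only a rewriting of [sq h] as an instance of [sq_cvg], with weight 0 on the zero point. *)
have E : sq h = sq (fun i => 0 * 0 + (1 - 0) * h i).
  by apply: eq_bigr => i _; rewrite mul0r add0r subr0 mul1r.
rewrite E; apply/ler_addgt0Pr => e e0.
rewrite -(cvg_lim _ (sq_cvg (x := fun=> 0) (t := 0))) //.
apply: limr_le; first by apply/cvg_ex; eexists; exact: sq_cvg.
apply: filterS (near_infty_natSinv_lt (PosNum e0)) => n /= ne.
have -> : sq (fun i => 0 * 0 + (1 - 0) * u n i) = sq (u n).
  by apply: eq_bigr => i _; rewrite mul0r add0r subr0 mul1r.
by apply: le_trans (ltW (u_lt n)) _; rewrite lerD2l ltW.
Qed.

(** The functional is the limit [h] itself: if some [x] had inner product [p < d] with [h], moving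
    from [h] towards [x] would bring the squared norm below [d]. *)
Lemma min_norm_separation : exists g : I -> R,
  forall x, T x -> r <= \sum_i g i * x i.
Proof.
exists h => x Tx; apply: le_trans r_le_d _.
set p := \sum_i _; rewrite leNgt; apply/negP => pd.
have E t : sq (fun i => t * x i + (1 - t) * h i) =
    t ^+ 2 * sq x + 2 * t * (1 - t) * p + (1 - t) ^+ 2 * sq h.
  rewrite /sq /p !mulr_sumr -!big_split /=.
  by apply: eq_bigr => i _; ring.
have K0 : 0 <= sq x - 2 * p + sq h.
  have <- : sq (fun i => x i - h i) = sq x - 2 * p + sq h.
    rewrite /sq /p mulr_sumr -sumrB -big_split /=.
    by apply: eq_bigr => i _; ring.
  exact: sq_ge0.
set K := sq x - 2 * p + sq h in K0.
have Kp : 0 < K + (d - p) by lra.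
(* Here [K] is the squared distance from [x] to [h]. The summand [d - p] in the denominator keeps
   [t] at most 1, and the squared norm at [t] comes out as [d - t (1 + t) (d - p)]. *)
pose t := (d - p) / (K + (d - p)).
have t0 : 0 < t by rewrite divr_gt0 // subr_gt0.
have t1 : t <= 1 by rewrite ler_pdivrMr // mul1r lerDr.
have tE : t * (K + (d - p)) = d - p by rewrite divfK // gt_eqF.
have := d_le_h Tx (t := t); rewrite t1 (ltW t0) => /(_ isT); rewrite E.
have := sq_h; have := d_le_h Tx (t := 0); rewrite lexx ler01 E => /(_ isT).
move: tE pd; rewrite /K; move: (sq x) (sq h) => a b tE pd db bd.
have {db bd} bE : b = d by apply/eqP; rewrite eq_le bd; move: db => /=; lra.
have -> : t ^+ 2 * a + 2 * t * (1 - t) * p + (1 - t) ^+ 2 * b =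
  b + t * (t * (a - 2 * p + b) - 2 * (b - p)) by ring.
have : t * (a - 2 * p + b) = (d - p) * (1 - t) by move: tE => *; lra.
move=> ->; rewrite bE => *; nra.
Qed.

End Separation.

(** For Hermitian [X] the real trace pairing is the Euclidean inner product of the real and
    imaginary parts, to which [min_norm_separation] applies. *)
Lemma Re_tr_mul_herm k (A X : 'M[C]_k) : adj X = X ->
  complex.Re (\tr (A *m X)) = \sum_i \sum_j
    (complex.Re (A i j) * complex.Re (X i j) + complex.Im (A i j) * complex.Im (X i j)).
Proof.
move=> hX; rewrite Re_sum; apply: eq_bigr => i _; rewrite mxE Re_sum.
apply: eq_bigr => j _; rewrite -{1}hX adjE conjE.
by case: (A i j) (X i j) => [a b] [x y] /=; rewrite mulrN opprK.
Qed.

Lemma Re_tr_adj_mul_herm k (A X : 'M[C]_k) : adj X = X ->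
  complex.Re (\tr (adj A *m X)) = complex.Re (\tr (A *m X)).
Proof.
move=> hX; rewrite -{1}hX -adjM.
have -> : \tr (adj (X *m A)) = (\tr (X *m A))^*.
  by rewrite /mxtrace rmorph_sum; apply: eq_bigr => i _; rewrite adjE.
by rewrite Re_conjc mxtrace_mulC.
Qed.

Lemma herm_separation k (T : set 'M[C]_k) (r : R) : T !=set0 ->
  (forall X, T X -> adj X = X) ->
  (forall X Y t, T X -> T Y -> 0 <= t <= 1 -> T (toC t *: X + toC (1 - t) *: Y)) ->
  (forall X, T X -> r <= complex.Re (\tr (X *m X))) ->
  exists2 H : 'M[C]_k, adj H = H &
    forall X, T X -> r <= complex.Re (\tr (H *m X)).
Proof.
move=> T0 Th Tc Tr.
pose enc (X : 'M[C]_k) (p : 'I_k * 'I_k * bool) : R :=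
  if p.2 then complex.Re (X p.1.1 p.1.2) else complex.Im (X p.1.1 p.1.2).
have bigE (F : 'I_k * 'I_k * bool -> R) :
    \sum_p F p = \sum_i \sum_j (F (i, j, true) + F (i, j, false)).
  transitivity (\sum_p \sum_c F (p, c)).
    by rewrite pair_big; apply: eq_bigr => -[].
  by rewrite [RHS]pair_big; apply: eq_bigr => -[i j] _; rewrite big_bool.
have [|||g hg] := @min_norm_separation _ [set enc X | X in T] r.
- by case: T0 => X TX; exists (enc X), X.
- move=> _ _ t [X TX <-] [Y TY <-] t01; exists (toC t *: X + toC (1 - t) *: Y).
    exact: Tc.
  apply/funext => -[[i j] c]; rewrite /enc /= !mxE.
  by case: c; case: (X i j) (Y i j) => [? ?] [? ?] /=; ring.
- move=> _ [X TX <-]; rewrite bigE.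
  by have := Tr _ TX; rewrite (Re_tr_mul_herm _ (Th _ TX)); congr (_ <= _).
pose H0 : 'M[C]_k := \matrix_(i, j) (Complex (g (i, j, true)) (g (i, j, false))).
(* The separating vector gives an arbitrary matrix [H0]; its Hermitian part has the same real
   pairing with Hermitian matrices. *)
exists (toC 2^-1 *: (H0 + adj H0)).
  by rewrite adj_scale conj_toC adjD adjK addrC.
move=> X TX; rewrite -scalemxAl mxtraceZ ReZ mulmxDl mxtraceD ReD.
rewrite (Re_tr_adj_mul_herm _ (Th _ TX)).
have half (x : R) : 2^-1 * (x + x) = x by field.
rewrite half.
rewrite (Re_tr_mul_herm _ (Th _ TX)).
have := hg (enc X) (ex_intro2 _ _ X TX erefl); rewrite bigE; congr (_ <= _).
by apply: eq_bigr => i _; apply: eq_bigr => j _; rewrite !mxE.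
Qed.

(** Each eigenvalue is at most the root of the sum of all squared eigenvalues. *)
Lemma herm_le_frobenius k (X : 'M[C]_k) : adj X = X ->
  loew X (toC (Num.sqrt (complex.Re (\tr (X *m X)))))%:M.
Proof.
move=> hX; have [U [d [uU eX]]] := herm_decomp hX.
have -> : complex.Re (\tr (X *m X)) = \sum_i d 0 i ^+ 2.
  rewrite eX (unitary_sqr _ uU) mxtrace_mulC mulmxA (unitary_adjr uU) mul1mx.
  by rewrite mxtrace_diag Re_sum; apply: eq_bigr => i _; rewrite !mxE.
rewrite {1}eX -(unitary_scalar _ uU); apply: loew_congdiag_unitary => i; rewrite mxE.
apply: le_trans (ler_norm _) _; rewrite -sqrtr_sqr ler_wsqrtr //.
by rewrite (bigD1 i) //= lerDl; apply: sumr_ge0 => j _; exact: sqr_ge0.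
Qed.

(** Adding [e I] makes [H] invertible and its trace positive. With [H = 0] this also shows that
    density operators exist. *)
Lemma density_of_psd k (H : 'M[C]_k) (e : R) : (0 < k)%N -> psd H -> 0 < e ->
  let w := toC (complex.Re (\tr H) + e * k%:R)^-1 *: (H + (toC e)%:M) in
  density w /\ w \in unitmx.
Proof.
move=> k0 pH e0 w; set t := complex.Re (\tr H) + e * k%:R.
have t0 : 0 < t.
  by rewrite ltr_wpDl ?mulr_gt0 ?ltr0n //; apply/ge0_Re/psd_tr_ge0.
have trE : \tr (H + (toC e)%:M) = toC t.
  rewrite mxtraceD mxtrace_scalar {1}(ge0_toC (psd_tr_ge0 pH)) /t toCD toCM.
  congr (_ + _); rewrite -[LHS]mulr_natr; congr (_ * _).
  exact/esym/(rmorph_nat (real_complex R) k).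
split; last first.
  rewrite /w unitmxZ ?psd_add_scalar_unit // unitfE.
  by apply/eqP => /complexI /eqP; rewrite invr_eq0 gt_eqF.
split; last by rewrite mxtraceZ trE -toCM mulVf ?gt_eqF.
by apply: psdZ; [rewrite invr_ge0 ltW|apply: psd_add_scalar => //; apply: ltW].
Qed.

(** Minimax core: a single invertible state must serve all of [S]. The gap between [c] and [c'] pays
    for the perturbation that makes the state invertible. *)
Lemma density_lower_bound k (S : set 'M[C]_k) (c c' : R) : (0 < k)%N ->
  0 <= c -> c < c' -> (forall B, S B -> psd B) ->
  (forall A B t, S A -> S B -> 0 <= t <= 1 -> S (toC t *: A + toC (1 - t) *: B)) ->
  (forall B, S B -> c' <= opnorm B) ->
  exists w, [/\ density w, w \in unitmx &
    forall B, S B -> c <= complex.Re (\tr (w *m B))].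
Proof.
move=> k0 c0 cc' Sp Sc So.
have [->|/set0P[B0 SB0]] := eqVneq S set0.
  have [] := density_of_psd k0 (psd0 _ k) (@ltr01 R).
  by eexists; split; eauto.
pose T : set 'M[C]_k :=
  [set X | exists B P, [/\ S B, psd P & X = B - (toC c)%:M + P]].
pose r := (c' - c) ^+ 2.
have r0 : 0 < r by rewrite exprn_gt0 // subr_gt0.
have Th X : T X -> adj X = X.
  by move=> [B [P [SB pP ->]]]; rewrite adjD adjB (Sp _ SB).1 pP.1 adj_scalar.
have [||X Y t|X TX|H hH sepH] := @herm_separation k T r.
- by exists (B0 - (toC c)%:M + 0), B0, 0; split=> //; exact: psd0.
- exact: Th.
- move=> [B [P [SB pP ->]]] [B' [P' [SB' pP' ->]]] /[dup] t01 /andP[t0 t1].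
  exists (toC t *: B + toC (1 - t) *: B'), (toC t *: P + toC (1 - t) *: P').
  split; first exact: Sc.
    by apply: psdD; apply: psdZ; rewrite ?subr_ge0.
  rewrite !scalerDr addrACA; congr (_ + _); rewrite addrACA; congr (_ + _).
  by rewrite !scalerN -opprD -scalerDl -toCD subrKC toC1 scale1r.
- have [B [P [SB pP eX]]] := TX; have hX := herm_le_frobenius (Th _ TX).
  set f := Num.sqrt _ in hX; have f0 : 0 <= f by exact: sqrtr_ge0.
  (* Since [X <= f I] with [f] the Frobenius norm of [X], [B = X + c I - P <= (c + f) I]. Hence
     [c' <= c + f], so [f^2] is at least [r]. *)
  have hB : loew B (toC (c + f))%:M.
    rewrite /loew; have -> : (toC (c + f))%:M - B = (toC f)%:M - X + P.
      rewrite toCD raddfD eX /=; move: (_%:M) (_%:M) => a b.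
      by rewrite opprD opprB addrA subrK addrCA addrA.
    exact: psdD hX pP.
  have := opnorm_le k0 (Sp _ SB) hB (addr_ge0 c0 f0).
  move=> /(le_trans (So _ SB)) h; rewrite /r -[leRHS]sqr_sqrtr -/f.
    by rewrite ler_sqr ?nnegrE ?subr_ge0 ?(ltW cc') // lerBlDl.
  have := psd_tr_ge0 (psd_gram X); rewrite (Th _ TX); exact: ge0_Re.
pose a := complex.Re (\tr (H *m (B0 - (toC c)%:M))).
have pH : psd H.
  apply/psdE; split=> // v; rewrite leNgt; apply/negP => s0.
  set s := complex.Re _ in s0.
  (* If [H] were negative at [v], adding the multiple [t] of [v^* v] to a point of the set would
     bring the functional down to [a - (|a| + 1) < 0], below [r]. *)
  pose t := (`|a| + 1) / - s.
  have t0 : 0 <= t by rewrite divr_ge0 ?addr_ge0 // oppr_ge0 ltW.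
  have TP : T (B0 - (toC c)%:M + toC t *: (adj v *m v)).
    by exists B0, (toC t *: (adj v *m v)); split=> //; apply/psdZ/psd_gram.
  have := sepH _ TP; rewrite mulmxDr mxtraceD ReD -/a -scalemxAr mxtraceZ ReZ.
  have -> : \tr (H *m (adj v *m v)) = sform H v v.
    by rewrite mulmxA mxtrace_mulC mulmxA trace_mx11 -sformE.
  have tsE : t * s = - (`|a| + 1) by rewrite /t invrN mulrN mulNr divfK // lt_eqF.
  by rewrite -/s tsE; have := ler_norm a; lra.
(* The perturbation costs [c e k], which must not exceed [r]; the 1 keeps the denominator positive
   when [c = 0]. *)
pose e := r / (k%:R * c + 1).
have kc : 0 < k%:R * c + 1 by rewrite ltr_wpDl // mulr_ge0.
have e0 : 0 < e by rewrite divr_gt0.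
have [dw uw] := density_of_psd k0 pH e0.
eexists; split; [exact: dw|exact: uw|] => B SB.
have tH : 0 <= complex.Re (\tr H) by apply/ge0_Re/psd_tr_ge0.
rewrite -scalemxAl mxtraceZ ReZ mulrC ler_pdivlMr; last first.
  by rewrite ltr_wpDl // mulr_gt0 ?ltr0n.
have TB : T (B - (toC c)%:M + 0) by exists B, 0; split=> //; exact: psd0.
have := sepH _ TB.
have -> : complex.Re (\tr (H *m (B - (toC c)%:M + 0))) =
    complex.Re (\tr (H *m B)) - c * complex.Re (\tr H).
  by rewrite addr0 mulmxBr mul_mx_scalar raddfB /= mxtraceZ ReD ReN ReZ.
have -> : complex.Re (\tr ((H + (toC e)%:M) *m B)) =
    complex.Re (\tr (H *m B)) + e * complex.Re (\tr B).
  by rewrite mulmxDl mul_scalar_mx mxtraceD mxtraceZ ReD ReZ.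
move=> h1.
have tB : 0 <= e * complex.Re (\tr B).
  by rewrite mulr_ge0 ?(ltW e0) //; apply/ge0_Re/psd_tr_ge0/Sp.
have er : e * (k%:R * c + 1) = r by rewrite divfK // gt_eqF.
move: h1 tB; move: (complex.Re _) (complex.Re _) (complex.Re _) => *; lra.
Qed.

End Minimax.

(** * Channel divergences *)

Section Channel.
Variable R : realType.
Local Notation C := (R[i]).

(** On nonnegative extended reals, [x |-> k lne x] is left adjoint to [y |-> expeR (y / k)], hence
    preserves suprema, the values [-oo] and [+oo] included. Nonemptiness makes the supremum itself
    nonnegative. *)
Lemma ereal_sup_lne (S : set (\bar R)) (k : R) : 0 < k -> S !=set0 ->
  (forall x, S x -> (0 <= x)%E) ->
  ereal_sup [set (k%:E * lne x)%E | x in S] = (k%:E * lne (ereal_sup S))%E.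
Proof.
move=> k0 [x0 Sx0] S0.
have adjoint (x y : \bar R) : (0 <= x)%E ->
    (k%:E * lne x <= y)%E = (x <= expeR (k^-1%:E * y))%E.
  move=> x_ge0; rewrite -lee_pdivlMl // -[in LHS]lee_expeR lneK //.
  by rewrite in_itv /= x_ge0 leey.
have supS0 : (0 <= ereal_sup S)%E.
  exact: le_trans (S0 _ Sx0) (ereal_sup_ubound Sx0).
apply/eqP; rewrite eq_le; apply/andP; split.
  apply: ge_ereal_sup => _ [x Sx <-]; rewrite adjoint; last exact: S0.
  apply: le_trans (ereal_sup_ubound Sx) _.
  by rewrite -adjoint.
rewrite adjoint //; apply: ge_ereal_sup => x Sx; rewrite -adjoint; last exact: S0.
by apply: ereal_sup_ubound; exists x.
Qed.

Lemma Qsharp_ge0 k (a : R) (rho sigma : 'M[C]_k) : (0 <= Qsharp a rho sigma)%E.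
Proof.
apply: le_ereal_inf_tmp => _ [A [pA _] <-]; rewrite lee_fin.
exact/ge0_Re/psd_tr_ge0.
Qed.

Variables (n m : nat).
Local Notation W w := (mxpow w 2^-1 *t (1%:M : 'M[C]_m)).

Lemma adj_sandwich (w : 'M[C]_n) : psd w -> adj (W w) = W w.
Proof. by move=> pw; rewrite adj_tens adjmx1 (mxpow_half pw).1. Qed.

Lemma psd_sandwich (w : 'M[C]_n) (J : 'M[C]_(n * m)) : psd w -> psd J ->
  psd (sandwich w J).
Proof. by move=> pw /(psd_congr (W w)); rewrite adj_sandwich. Qed.

Lemma tr_sandwich (w : 'M[C]_n) (A : 'M[C]_(n * m)) : psd w ->
  \tr (sandwich w A) = \tr (w *m ptrY A).
Proof.
move=> pw; rewrite /sandwich mxtrace_mulC mulmxA tensmx_mul mulmx1.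
by rewrite (mxpow_half pw).2 tr_tens_ptrY.
Qed.

Definition feasible b (rho sigma : 'M[C]_(n * m)) : set 'M[C]_(n * m) :=
  [set A | psd A /\ loew rho (gmean b sigma A)].

Lemma feasible_sandwich b (w : 'M[C]_n) (rho sigma A : 'M[C]_(n * m)) :
  0 <= b <= 1 -> psd w -> psd sigma -> feasible b rho sigma A ->
  feasible b (sandwich w rho) (sandwich w sigma) (sandwich w A).
Proof.
move=> b01 pw ps [pA H]; split; first exact: psd_sandwich.
have := loew_gmean_congr (W w) b01 ps pA H.
by rewrite (adj_sandwich pw).
Qed.

(** Congruence by [w^(-1/2)] tensored with the identity undoes the sandwich, so for invertible [w]
    the feasible sets correspond and the objective becomes [tr (w tr_Y B)]. *)
Lemma feasible_unsandwich b (w : 'M[C]_n) (rho sigma A : 'M[C]_(n * m)) :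
  0 <= b <= 1 -> psd w -> w \in unitmx -> psd sigma ->
  feasible b (sandwich w rho) (sandwich w sigma) A ->
  exists2 B, feasible b rho sigma B & A = sandwich w B.
Proof.
move=> b01 pw uw ps [pA H].
have [hH HH] := mxpow_half pw.
have uH : mxpow w 2^-1 \in unitmx by move: uw; rewrite -{1}HH unitmx_mul => /andP[].
pose V : 'M[C]_(n * m) := invmx (mxpow w 2^-1) *t 1%:M.
have hV : adj V = V by rewrite adj_tens adjmx1 adj_invmx hH.
have VW : V *m W w = 1%:M by rewrite tensmx_mul mulVmx // mulmx1 tens1mx1.
have WV : W w *m V = 1%:M by rewrite tensmx_mul mulmxV // mulmx1 tens1mx1.
have VJ (J : 'M[C]_(n * m)) : V *m sandwich w J *m adj V = J.
  by rewrite hV /sandwich -!mulmxA WV mulmx1 mulmxA VW mul1mx.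
exists (V *m A *m adj V).
  split; first exact: psd_congr.
  have := loew_gmean_congr V b01 (psd_sandwich pw ps) pA H.
  by rewrite !VJ.
by rewrite hV /sandwich -!mulmxA VW mulmx1 mulmxA WV mul1mx.
Qed.

Lemma feasible_convex b (rho sigma A B : 'M[C]_(n * m)) t : 0 <= b <= 1 ->
  psd sigma -> feasible b rho sigma A -> feasible b rho sigma B -> 0 <= t <= 1 ->
  feasible b rho sigma (toC t *: A + toC (1 - t) *: B).
Proof.
move=> b01 ps [pA HA] [pB HB] /[dup] t01 /andP[t0 t1]; split.
  by apply: psdD; apply: psdZ; rewrite ?subr_ge0.
exact: loew_gmean_convex.
Qed.

(** One inequality is [tr (w B) <= ||B||] for each state. For the other, a strict gap leaves room
    for [c < c'], and [density_lower_bound] gives a state of value at least [c], above the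
    supremum. *)
Lemma minimax_Qsharp (a : R) (rho sigma : 'M[C]_(n * m)) :
  (0 < n)%N -> 1 < a -> psd sigma ->
  ereal_sup [set Qsharp a (sandwich w rho) (sandwich w sigma) | w in
    [set w : 'M[C]_n | density w]] =
  ereal_inf [set (opnorm (ptrY A))%:E | A in feasible a^-1 rho sigma].
Proof.
move=> n0 a1 ps; have a0 : 0 < a := lt_trans ltr01 a1.
have b01 : 0 <= a^-1 <= 1 by rewrite invr_ge0 ltW //= invf_le1 // ltW.
set Ls := [set _ | _ in _]; set I := ereal_inf _.
have [dn _] := density_of_psd n0 (psd0 R n) (@ltr01 R).
have L0 : (0 <= ereal_sup Ls)%E.
  apply: (@le_trans _ _ (Qsharp a (sandwich _ rho) (sandwich _ sigma))).
    exact: Qsharp_ge0.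
  by apply: ereal_sup_ubound; eexists; [exact: dn|].
apply/eqP; rewrite eq_le; apply/andP; split.
  apply: ge_ereal_sup => _ [w dw <-]; apply: le_ereal_inf_tmp => _ [A fA <-].
  have := feasible_sandwich b01 dw.1 ps fA => fA'.
  apply: (@le_trans _ _ (complex.Re (\tr (sandwich w A)))%:E).
    by apply: ereal_inf_lbound; exists (sandwich w A).
  rewrite lee_fin (tr_sandwich _ dw.1); apply: tr_density_le_opnorm; first exact: dw.
  exact: psd_ptrY fA.1.
rewrite leNgt; apply/negP => LI.
have [c [c' [c0 Lc cc' c'I]]] : exists c c' : R,
    [/\ 0 <= c, (ereal_sup Ls < c%:E)%E, c < c' & (c'%:E <= I)%E].
  move: L0 LI; case: (ereal_sup Ls) => [l| |] //; last by case: (I).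
  rewrite lee_fin => l0; case: (I) => [i| |] // => [|_].
    rewrite lte_fin => li; exists ((l + i) / 2), i; rewrite !lte_fin lee_fin lexx.
    by split=> //; lra.
  (* The infimum is [+oo] here, for instance over an empty feasible set, and any two reals above [l]
     will do. *)
  exists (l + 1), (l + 2); rewrite lte_fin leey; split=> //; lra.
have [|||w [dw uw hw]] := @density_lower_bound R n
  [set ptrY A | A in feasible a^-1 rho sigma] c c' n0 c0 cc'.
- by move=> _ [A [pA _] <-]; apply: psd_ptrY.
- move=> _ _ t [A fA <-] [B fB <-] t01; exists (toC t *: A + toC (1 - t) *: B).
    exact: feasible_convex.
  by rewrite ptrYD !ptrYZ.
- move=> _ [A fA <-]; rewrite -lee_fin; apply: le_trans c'I _.
  by apply: ereal_inf_lbound; exists A.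
have : (c%:E <= Qsharp a (sandwich w rho) (sandwich w sigma))%E.
  apply: le_ereal_inf_tmp => _ [A fA <-].
  have [B fB ->] := feasible_unsandwich b01 dw.1 uw ps fA.
  by rewrite lee_fin (tr_sandwich _ dw.1); apply: hw; exists B.
apply/negP; rewrite -ltNge; apply: le_lt_trans Lc.
by apply: ereal_sup_ubound; exists w.
Qed.

End Channel.

Theorem theorem4p1 (R : realType) (n m : nat) (alpha : R)
  (N M : {linear 'M[R[i]]_n -> 'M[R[i]]_m}) :
  (0 < n)%N -> 1 < alpha ->
  completely_positive N -> completely_positive M ->
  Dsharp_ch alpha N M = (((alpha - 1)^-1)%:E * log2e (Qsharp_ch alpha N M))%E /\
  Qsharp_ch alpha N M =
    ereal_inf [set (opnorm (ptrY A))%:E |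
               A in [set A : 'M[R[i]]_(n * m) |
                     psd A /\ loew (choi N) (gmean alpha^-1 (choi M) A)]].
Proof.
move=> n0 a1 _ cpM; split; last exact: minimax_Qsharp n0 a1 (psd_choi cpM).
(* The prefactor and the change of base to 2 merge into one positive constant, so the supremum
   commutes with the logarithm. *)
have k0 : 0 < (alpha - 1)^-1 * (ln (2 : R))^-1.
  by rewrite mulr_gt0 ?invr_gt0 ?subr_gt0 // ln_gt0 // ltr1n.
have logE (x : \bar R) : (((alpha - 1)^-1)%:E * log2e x)%E =
    (((alpha - 1)^-1 * (ln (2 : R))^-1)%:E * lne x)%E.
  by rewrite /log2e (muleC (lne x)) muleA EFinM.
have [dn _] := density_of_psd n0 (psd0 R n) (@ltr01 R).
rewrite logE -ereal_sup_lne //.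
- congr ereal_sup; apply/seteqP; split=> y [x].
    move=> dx <-; exists (Qsharp alpha (sandwich x (choi N)) (sandwich x (choi M))).
      by exists x.
    by rewrite /Dsharp logE.
  by move=> [w dw <-] <-; exists w => //; rewrite /Dsharp logE.
- by eexists; eexists; first exact: dn.
- by move=> _ [w _ <-]; exact: Qsharp_ge0.
Qed.
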